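(* Let $n \geq 3$, and let $\mathbb{F}$ be a field with $\operatorname{char}(\mathbb{F})=2$ and $|\mathbb{F}|>2$. Then the greatest possible dimension for a $2$-spec linear subspace of $\operatorname{M}_n(\mathbb{F})$ is $\binom{n}{2}+3$ if $n\neq 4$, and $\binom{n}{2}+4$ if $n=4$. The same holds (the greatest possible dimension has the same value) if the $2$-spec property is replaced with the $\overline{2}$-spec property.
   Context: $\operatorname{M}_n(\mathbb{F})$ is the algebra of $n\times n$ matrices over $\mathbb{F}$, and $\overline{\mathbb{F}}$ is an algebraic closure of $\mathbb{F}$. For a field extension $\mathbb{L}$ of $\mathbb{F}$, $\operatorname{Sp}_{\mathbb{L}}(x)$ is the set of roots in $\mathbb{L}$ of the minimal polynomial of $x$. An $\mathbb{F}$-linear subspace $\mathcal{S}$ of $\operatorname{M}_n(\mathbb{F})$ is called $2$-spec if $\#\operatorname{Sp}_{\mathbb{F}}(x)\leq 2$ for all $x\in\mathcal{S}$, and $\overline{2}$-spec if $\#\operatorname{Sp}_{\overline{\mathbb{F}}}(x)\leq 2$ for all $x\in\mathcal{S}$. *)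

(* Defs.v *)
From mathcomp Require Import all_boot all_order all_algebra.

Set Implicit Arguments.
Unset Strict Implicit.
Unset Printing Implicit Defensive.

Import GRing.Theory.
Local Open Scope ring_scope.

(* The library's minimal polynomial mxminpoly is only available for matrices
   of size m.+1; the index n below is therefore one less than the matrix size. *)

Definition spectrum (F L : fieldType) (iota : {rmorphism F -> L}) (n : nat)
    (x : 'M[F]_n.+1) : pred L :=
  root (map_poly iota (mxminpoly x)).

Definition card_at_most (T : eqType) (k : nat) (P : pred T) : Prop :=
  forall s : seq T, uniq s -> all P s -> (size s <= k)%N.

Definition spec_in (F L : fieldType) (iota : {rmorphism F -> L}) (k n : nat)
    (S : {vspace 'M[F]_n.+1}) : Prop :=
  forall x : 'M[F]_n.+1, x \in S -> card_at_most k (spectrum iota x).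

Definition two_spec (F : fieldType) (n : nat) (S : {vspace 'M[F]_n.+1}) : Prop :=
  spec_in (idfun : {rmorphism F -> F}) 2 S.

(* Fbar, with the embedding iota, is meant to be an algebraic closure of F. *)
Definition two_bar_spec (F Fbar : fieldType) (iota : {rmorphism F -> Fbar})
    (n : nat) (S : {vspace 'M[F]_n.+1}) : Prop :=
  spec_in iota 2 S.

Definition algebraic_closure (F : fieldType) (Fbar : closedFieldType)
    (iota : {rmorphism F -> Fbar}) : Prop :=
  forall z : Fbar, algebraicOver iota z.

Definition greatest_dim (F : fieldType) (V : vectType F)
    (P : {vspace V} -> Prop) (d : nat) : Prop :=
  (exists2 S : {vspace V}, P S & \dim S = d) /\
  (forall S : {vspace V}, P S -> (\dim S <= d)%N).

(* Main.v *)
From HB Require Import structures.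
Require Import Defs.
From Stdlib Require Import Classical.
From mathcomp Require Import all_boot all_order all_algebra.
From mathcomp Require Import ring zify.

Set Implicit Arguments.
Unset Strict Implicit.
Unset Printing Implicit Defensive.

Import GRing.Theory.
Local Open Scope ring_scope.

(** Write e#r for the rank one matrix r^T e, acting on row vectors by
    u |-> <u, r> e.  For a nonzero vector e, the matrices of S killing e act on
    V / Fe, with kernel the matrices e#r of S; when S is 2-spec they have there at
    most one nonzero eigenvalue.  Hence
      dim S <= dim (e S) + dim {e#r in S, <e, r> = 0} + dim (action on V / Fe),
    and induction gives the bounds C(n,2) for trivial spectrum, C(n,2)+2 for at
    most one nonzero eigenvalue (n >= 2) and C(n,2)+3 for 2-spec, as soon as some
    vector, or some covector after transposition, is good: the middle term is zero.

    If every vector is bad, a greedy choice yields a 2-cycle: e1#r1 and e2#r2 in S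
    with <e1, r1> = <e2, r2> = 0 and <e1, r2>, <e2, r1> nonzero.  In characteristic
    2 it contributes a single eigenvalue, which can be prescribed.  When all vectors
    and all covectors are bad, either there is a second 2-cycle, triangular with
    respect to the first one, giving two prescribed nonzero eigenvalues, and a third
    eigenvalue 0 if n > 4; or three rank one matrices combine into a matrix with
    characteristic polynomial t^(n-3) (t - 1) (t - x) (t - x - 1), where x <> 0, 1.
    For n = 4 some vector or covector has a middle term of dimension at most 1:
    otherwise all vectors and covectors remain bad in a quotient of dimension 3. *)

(** * Rank one matrices and greedily built 2-cycles *)

Section RankOne.

Variables (F : fieldType) (n : nat).
Implicit Types (e r u v : 'rV[F]_n) (S : {vspace 'M[F]_n}).

Definition dot e r : F := (e *m r^T) 0 0.
Definition tens e r : 'M[F]_n := r^T *m e.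

Lemma dotC e r : dot e r = dot r e.
Proof. by rewrite /dot -[r in RHS]trmxK -trmx_mul [RHS]mxE. Qed.

Lemma dotDl e1 e2 r : dot (e1 + e2) r = dot e1 r + dot e2 r.
Proof. by rewrite /dot mulmxDl mxE. Qed.

Lemma dotZl a e r : dot (a *: e) r = a * dot e r.
Proof. by rewrite /dot -scalemxAl mxE. Qed.

Lemma dotDr e r1 r2 : dot e (r1 + r2) = dot e r1 + dot e r2.
Proof. by rewrite dotC dotDl !(dotC _ e). Qed.

Lemma dotZr a e r : dot e (a *: r) = a * dot e r.
Proof. by rewrite dotC dotZl dotC. Qed.

Lemma dot0l r : dot 0 r = 0. Proof. by rewrite /dot mul0mx mxE. Qed.
Lemma dot0r e : dot e 0 = 0. Proof. by rewrite dotC dot0l. Qed.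

Definition dotE := (dotDl, dotDr, dotZl, dotZr, dot0l, dot0r).

Lemma dot_delta e i : dot e (delta_mx 0 i) = e 0 i.
Proof. by rewrite /dot trmx_delta -colE mxE. Qed.

Lemma mulmx_dot e r : e *m r^T = (dot e r)%:M.
Proof. exact: mx11_scalar. Qed.

Lemma mul_tens u e r : u *m tens e r = dot u r *: e.
Proof. by rewrite /tens mulmxA mulmx_dot mul_scalar_mx. Qed.

Lemma tr_tens e r : (tens e r)^T = tens r e.
Proof. by rewrite /tens trmx_mul trmxK. Qed.

Lemma tensDl e1 e2 r : tens (e1 + e2) r = tens e1 r + tens e2 r.
Proof. exact: mulmxDr. Qed.

Lemma tensZl a e r : tens (a *: e) r = a *: tens e r.
Proof. by rewrite /tens -scalemxAr. Qed.

Lemma tensDr e r1 r2 : tens e (r1 + r2) = tens e r1 + tens e r2.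
Proof. by rewrite /tens linearD mulmxDl. Qed.

Lemma tensZr a e r : tens e (a *: r) = a *: tens e r.
Proof. by rewrite /tens linearZ -scalemxAl. Qed.

Lemma tens0l r : tens 0 r = 0. Proof. exact: mulmx0. Qed.
Lemma tens0r e : tens e 0 = 0. Proof. by rewrite /tens trmx0 mul0mx. Qed.

Lemma neq0_dot e : e != 0 -> exists r, dot e r = 1.
Proof.
case/rV0Pn=> i ei; exists ((e 0 i)^-1 *: delta_mx 0 i).
by rewrite dotZr dot_delta mulVf.
Qed.

(* The vectors e_1, e_2, ... are built greedily: without a 2-cycle the
   covectors r_1, r_2, ... chosen so far stay independent modulo Z, so that
   the next constraint <e, r_i> = 1 can be added until the space is full. *)
Lemma two_cycle (B : 'rV[F]_n -> 'rV[F]_n -> Prop) m (Z : 'M[F]_(m, n))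
    (z : 'rV[F]_m) :
    (forall e r, B e r -> dot e r = 0) ->
    (exists e, e *m Z^T = z) ->
    (forall e, e *m Z^T = z -> exists2 r, B e r & ~~ (r <= Z)%MS) ->
  exists e1 r1 e2 r2, [/\ e1 *m Z^T = z, e2 *m Z^T = z, B e1 r1, B e2 r2 &
    dot e1 r2 != 0 /\ dot e2 r1 != 0].
Proof.
move=> B0; move: {2}(n - \rank Z)%N (leqnn (n - \rank Z)) => k.
elim: k => [|k IHk] in m Z z * => leZk [e eZ] bad; have [r Ber nrZ] := bad e eZ.
  by case/negP: nrZ; apply: submx_full; rewrite /row_full eqn_leq rank_leq_col; lia.
have er0 := B0 _ _ Ber.
have [[e2 [r2 [e2Z Be2 er2 e2r]]]|no2] := classic (exists e2 r2,
  [/\ e2 *m Z^T = z, B e2 r2, dot e r2 != 0 & dot e2 r != 0]).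
  by exists e, r, e2, r2.
have [||e' e'Z|] := IHk _ (col_mx Z r) (row_mx z 1%:M).
- have: (\rank Z < \rank (col_mx Z r))%N.
    have ltZ: (Z < col_mx Z r)%MS by rewrite ltmxE col_mx_sub submx_refl nrZ -addsmxE addsmxSl.
    by rewrite ltmxErank in ltZ; case/andP: ltZ.
  by move: leZk; lia.
(* A column of the cokernel of [Z] that does not kill [r]: adding a multiple of it to [e] keeps the
   old constraints and makes <e, r> = 1. *)
- move: nrZ; rewrite submxE => /rV0Pn[i ri].
  pose u := (row i (cokermx Z)^T).
  have uE: u = (col i (cokermx Z))^T by rewrite /u tr_col.
  exists (e + (dot u r)^-1 *: u); rewrite tr_col_mx mul_mx_row; congr row_mx.
    rewrite mulmxDl eZ -scalemxAl uE -trmx_mul colE mulmxA.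
    by rewrite (_ : Z *m cokermx Z = 0) ?mulmx_coker // mul0mx trmx0 scaler0 addr0.
  rewrite mulmx_dot dotDl er0 dotZl add0r mulVf //.
  by rewrite dotC /dot uE trmxK colE mulmxA -colE mxE.
- move: e'Z; rewrite tr_col_mx mul_mx_row => /eq_row_mx[e'Z e'r1].
  have [r' Be'r' nr'Z] := bad e' e'Z; exists r' => //.
  have e'r: dot e' r = 1 by rewrite /dot e'r1 mxE.
  have er': dot e r' = 0.
    apply/eqP/negPn/negP => er'; case: no2; exists e', r'.
    by rewrite e'r oner_neq0.
  apply: contra nr'Z => /submxP[D]; rewrite -[D]hsubmxK mul_row_col => r'E.
  set D1 := lsubmx D in r'E; set D2 := rsubmx D in r'E.
  (* Evaluating r' = D1 Z + D2 r at [e], where r and r' vanish, gives z D1^T = 0; evaluating at [e']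
     then leaves D2 = 0. *)
  have zD: z *m D1^T = 0.
    apply/rowP=> i; rewrite ord1 [RHS]mxE -er' /dot r'E linearD /= mulmxDr.
    by rewrite !trmx_mul !mulmxA eZ mulmx_dot er0 mul_scalar_mx scale0r addr0.
  have D20: D2 = 0.
    apply: trmx_inj; rewrite trmx0.
    apply/rowP=> i; rewrite ord1 [RHS]mxE -(B0 _ _ Be'r') /dot r'E linearD /= mulmxDr.
    by rewrite !trmx_mul !mulmxA e'Z zD add0r mulmx_dot e'r mul1mx.
  by rewrite r'E D20 mul0mx addr0 submxMl.
move=> e1 [r1 [e2 [r2 [e1Z e2Z ? ? ?]]]]; exists e1, r1, e2, r2.
by move: e1Z e2Z; rewrite tr_col_mx !mul_mx_row => /eq_row_mx[-> _] /eq_row_mx[-> _].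
Qed.

Lemma eigenvalue_tr (M : 'M[F]_n) a : eigenvalue M^T a = eigenvalue M a.
Proof.
by rewrite !eigenvalue_root_char /char_poly /char_poly_mx -map_trmx -[X in X - _]tr_scalar_mx -linearB det_tr.
Qed.

End RankOne.

(** * Spectral conditions and eigenvalues of sums of rank one matrices *)

Section FewEigenvalues.

Variables (F : fieldType) (n : nat).
Implicit Types (e r u v : 'rV[F]_n) (S : {vspace 'M[F]_n}).

Definition spec2 S := forall M a b c, M \in S ->
  eigenvalue M a -> eigenvalue M b -> eigenvalue M c -> ~~ uniq [:: a; b; c].

(** The eigenvalue 0 is not counted: this is what V / Fe inherits from a 2-spec space, where a
    matrix killing e already has the eigenvalue 0. *)
Definition spec1 S := forall M a b, M \in S -> a != 0 -> b != 0 ->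
  eigenvalue M a -> eigenvalue M b -> a = b.

Definition spec0 S := forall M a, M \in S -> eigenvalue M a -> a = 0.

(** [r] witnesses that [e] is bad, through a square zero matrix of [S]; r = 0 is allowed here and
    excluded in [all_bad]. *)
Definition bad S e r := tens e r \in S /\ dot e r = 0.

Lemma badZ S e r a : bad S e r -> bad S e (a *: r).
Proof. by case=> Ser er; split; rewrite (tensZr, dotZr) (memvZ, er) // mulr0. Qed.

Lemma spec1_spec2 S : spec1 S -> spec2 S.
Proof.
move=> S1 M a b c MS Ma Mb Mc; apply/negP; rewrite /= !inE negb_or andbT.
case/andP=> /andP[ab ac] bc.
have [a0|a0] := eqVneq a 0.
  case/eqP: bc; apply: (S1 M) => //; first by rewrite -a0 eq_sym.
  by rewrite -a0 eq_sym.
have [b0|b0] := eqVneq b 0.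
  by case/eqP: ac; apply: (S1 M) => //; rewrite -b0 eq_sym.
by case/eqP: ab; apply: (S1 M).
Qed.

(* The coordinates are a row of the adjugate of l - G, where G is the matrix of
   the g_ij; its trace is the derivative of the characteristic polynomial. *)
Lemma zero_diag_eigenvector (g12 g13 g21 g23 g31 g32 l : F) :
    let c := g12 * g21 + g13 * g31 + g23 * g32 in
    let p := g12 * g23 * g31 + g13 * g32 * g21 in
    l ^+ 3 = l * c + p -> 3%:R * l ^+ 2 - c != 0 ->
  exists x1 x2 x3, [/\ l * x1 = x2 * g21 + x3 * g31,
    l * x2 = x1 * g12 + x3 * g32, l * x3 = x1 * g13 + x2 * g23 &
    [|| x1 != 0, x2 != 0 | x3 != 0]].
Proof.
move=> c p lE dl.
have [d1|d1] := eqVneq (l ^+ 2 - g23 * g32) 0; last first.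
  exists (l ^+ 2 - g23 * g32), (l * g12 + g13 * g32), (l * g13 + g12 * g23).
  split; [| | | by rewrite d1]; rewrite /c /p in lE; try ring.
  by rewrite mulrBr -exprS lE; ring.
have [d2|d2] := eqVneq (l ^+ 2 - g13 * g31) 0; last first.
  exists (l * g21 + g23 * g31), (l ^+ 2 - g13 * g31), (l * g23 + g21 * g13).
  split; [| | | by rewrite d2 orbT]; rewrite /c /p in lE; try ring.
  by rewrite mulrBr -exprS lE; ring.
exists (l * g31 + g32 * g21), (l * g32 + g31 * g12), (l ^+ 2 - g12 * g21).
split; rewrite /c /p in lE dl; try ring.
  by rewrite mulrBr -exprS lE; ring.
apply/or3P/Or33; apply: contra dl => /eqP d3.
rewrite -[0]addr0 -{1}[0]addr0 -{1}d1 -{1}d2 -{1}d3; apply/eqP; ring.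
Qed.

(** On combinations of the e_i the sum acts through the Gram matrix of the <e_i, r_j>, with zero
    diagonal. An eigenvector x of it lifts to v = sum x_i e_i, nonzero because <v, r_i> = l x_i with
    l nonzero. *)
Lemma eigenvalue_tens3 e1 e2 e3 r1 r2 r3 l :
    dot e1 r1 = 0 -> dot e2 r2 = 0 -> dot e3 r3 = 0 ->
    let c := dot e1 r2 * dot e2 r1 + dot e1 r3 * dot e3 r1
             + dot e2 r3 * dot e3 r2 in
    let p := dot e1 r2 * dot e2 r3 * dot e3 r1
             + dot e1 r3 * dot e3 r2 * dot e2 r1 in
    l != 0 -> l ^+ 3 = l * c + p -> 3%:R * l ^+ 2 - c != 0 ->
  eigenvalue (tens e1 r1 + tens e2 r2 + tens e3 r3) l.
Proof.
move=> e11 e22 e33 c p l0 /zero_diag_eigenvector/[apply].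
case=> x1 [x2 [x3 [E1 E2 E3 x0]]]; apply/eigenvalueP.
pose v := x1 *: e1 + x2 *: e2 + x3 *: e3.
have v1: dot v r1 = l * x1 by rewrite /v !dotE e11 E1; ring.
have v2: dot v r2 = l * x2 by rewrite /v !dotE e22 E2; ring.
have v3: dot v r3 = l * x3 by rewrite /v !dotE e33 E3; ring.
exists v; first by rewrite !mulmxDr !mul_tens v1 v2 v3 /v !scalerDr !scalerA.
apply: contraL x0 => /eqP v0.
have lx y : 0 = l * y -> y = 0.
  by move/esym/eqP; rewrite mulf_eq0 (negPf l0) => /eqP.
by move: v1 v2 v3; rewrite v0 !dot0l => /lx-> /lx-> /lx->; rewrite eqxx.
Qed.

(** In characteristic 2 the two equations turn t^3 - c t - p into (t - 1) (t - x) (t - x - 1), with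
    distinct nonzero roots; the derivative at each root is the product of its differences with the
    other two. *)
Lemma spec2_tens3 S e1 e2 e3 r1 r2 r3 x : 2%:R = 0 :> F ->
    spec2 S -> tens e1 r1 + tens e2 r2 + tens e3 r3 \in S ->
    dot e1 r1 = 0 -> dot e2 r2 = 0 -> dot e3 r3 = 0 -> x != 0 -> x != 1 ->
    dot e1 r2 * dot e2 r1 + dot e1 r3 * dot e3 r1 + dot e2 r3 * dot e3 r2
      = x ^+ 2 + x + 1 ->
    dot e1 r2 * dot e2 r3 * dot e3 r1 + dot e1 r3 * dot e3 r2 * dot e2 r1
      = x ^+ 2 + x ->
  False.
Proof.
move=> h2 S2 MS e11 e22 e33 x0 x1 cE pE.
have x1' : x + 1 != 0.
  apply: contra_neq x1 => x1; have -> : x = x + 1 - 2%:R + 1 by ring.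
  by rewrite x1 h2 subrr add0r.
have eig l : l != 0 -> l ^+ 3 = l * (x ^+ 2 + x + 1) + (x ^+ 2 + x) ->
    3%:R * l ^+ 2 - (x ^+ 2 + x + 1) != 0 ->
    eigenvalue (tens e1 r1 + tens e2 r2 + tens e3 r3) l.
  by move=> l0 lE dl; apply: eigenvalue_tens3; rewrite ?cE ?pE.
have eig1 : eigenvalue (tens e1 r1 + tens e2 r2 + tens e3 r3) 1.
  apply: eig; rewrite ?oner_neq0 //; first by ring: h2.
  apply: contra_neq (mulf_neq0 x0 x1') => E.
  by rewrite -[RHS]oppr0 -E -[LHS]subr0 -h2; ring.
have eigx : eigenvalue (tens e1 r1 + tens e2 r2 + tens e3 r3) x.
  apply: eig => //; first by ring: h2.
  apply: contra_neq x1' => E.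
  by rewrite -[RHS]oppr0 -E -[LHS]subr0 -(mulr0 (x ^+ 2)) -h2; ring.
have eigx1 : eigenvalue (tens e1 r1 + tens e2 r2 + tens e3 r3) (x + 1).
  apply: eig => //; first by ring: h2.
  apply: contra_neq x0 => E.
  by rewrite -E -[LHS]addr0 -(mulr0 ((x + 1) ^+ 2)) -h2; ring.
apply/(negP (S2 _ _ _ _ MS eig1 eigx eigx1)).
rewrite /= !inE negb_or (eq_sym 1 x) x1 /= andbT; apply/andP; split.
  by rewrite -(inj_eq (addIr (- (1 : F)))) subrr addrK eq_sym.
by rewrite -subr_eq0 opprD addrA subrr add0r oppr_eq0 oner_neq0.
Qed.

(** Each cycle swaps its two vectors, and [M] is triangular since r1 and r2 kill f1 and f2. So f1 +
    f2 has eigenvalue b, and e1 + e2 has eigenvalue a modulo f1 and f2. *)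
Lemma pair_eigenvalues e1 e2 r1 r2 f1 f2 s1 s2 a b :
    dot e1 r1 = 0 -> dot e2 r2 = 0 -> dot e1 r2 = 1 -> dot e2 r1 = 1 ->
    dot f1 s1 = 0 -> dot f2 s2 = 0 -> dot f1 s2 = 1 -> dot f2 s1 = 1 ->
    dot f1 r1 = 0 -> dot f1 r2 = 0 -> dot f2 r1 = 0 -> dot f2 r2 = 0 ->
    a ^+ 2 != b ^+ 2 ->
  let M := a *: (tens e1 r1 + tens e2 r2) + b *: (tens f1 s1 + tens f2 s2) in
  eigenvalue M a /\ eigenvalue M b.
Proof.
move=> e11 e22 e12 e21 f11 f22 f12 f21 fr11 fr12 fr21 fr22 ab M.
have uM u : u *m M = a *: (dot u r1 *: e1 + dot u r2 *: e2)
                     + b *: (dot u s1 *: f1 + dot u s2 *: f2).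
  by rewrite mulmxDr -!scalemxAr !mulmxDr !mul_tens.
split; apply/eigenvalueP; last first.
  exists (f1 + f2); first by rewrite uM !dotE fr11 fr12 fr21 fr22 f11 f12 f21 f22
    !(add0r, addr0, scale0r, scaler0, scale1r).
  apply: contra_neq (oner_neq0 F) => f0.
  by rewrite -f21 -[LHS]add0r -f11 -dotDl f0 dot0l.
pose D := a ^+ 2 - b ^+ 2; have D0 : D != 0 by rewrite subr_eq0.
pose t1 := dot (e1 + e2) s1; pose t2 := dot (e1 + e2) s2.
(* The corrections l and m solve a l = b (t1 + m), a m = b (t2 + l), a system of determinant a^2 -
   b^2. *)
pose l := (a * b * t1 + b ^+ 2 * t2) / D; pose m := (a * b * t2 + b ^+ 2 * t1) / D.
pose v := e1 + e2 + (l *: f1 + m *: f2).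
have v1 : dot v r1 = 1 by rewrite /v !dotE e11 e21 fr11 fr21; ring.
have v2 : dot v r2 = 1 by rewrite /v !dotE e12 e22 fr12 fr22; ring.
have w1 : b * dot v s1 = a * l.
  by rewrite /v dotDl -/t1 !dotE f11 f21 /l /m /D; field; exact: D0.
have w2 : b * dot v s2 = a * m.
  by rewrite /v dotDl -/t2 !dotE f12 f22 /l /m /D; field; exact: D0.
exists v; first by rewrite uM v1 v2 !scalerDr !scalerA w1 w2 !mulr1.
by apply: contra_neq (oner_neq0 F) => v0; rewrite -v1 v0 dot0l.
Qed.

Lemma pair_free e1 e2 r1 r2 f1 f2 s1 s2 :
    dot e1 r1 = 0 -> dot e2 r2 = 0 -> dot e1 r2 = 1 -> dot e2 r1 = 1 ->
    dot f1 s1 = 0 -> dot f2 s2 = 0 -> dot f1 s2 = 1 -> dot f2 s1 = 1 ->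
    dot f1 r1 = 0 -> dot f1 r2 = 0 -> dot f2 r1 = 0 -> dot f2 r2 = 0 ->
  (4 <= n)%N.
Proof.
move=> e11 e22 e12 e21 f11 f22 f12 f21 fr11 fr12 fr21 fr22.
pose E : 'M[F]_(1 + 1 + (1 + 1), n) := col_mx (col_mx e1 e2) (col_mx f1 f2).
suff /eqP rE : row_free E by have := rank_leq_col E; rewrite rE.
apply: inj_row_free => v; rewrite -[v]hsubmxK -[lsubmx v]hsubmxK -[rsubmx v]hsubmxK.
rewrite !mul_row_col.
move: (lsubmx (lsubmx v)) (rsubmx (lsubmx v)) (lsubmx (rsubmx v)) (rsubmx (rsubmx v)).
move=> x1 x2 y1 y2; rewrite [x1]mx11_scalar [x2]mx11_scalar [y1]mx11_scalar
  [y2]mx11_scalar !mul_scalar_mx.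
move: (x1 0 0) (x2 0 0) (y1 0 0) (y2 0 0) => {}x1 {}x2 {}y1 {}y2 v0.
have := (congr1 (fun u => dot u r1) v0, congr1 (fun u => dot u r2) v0, congr1 (fun u => dot u s1) v0,
         congr1 (fun u => dot u s2) v0).
rewrite /= !dotE e11 e22 e12 e21 f11 f22 f12 f21 fr11 fr12 fr21 fr22.
rewrite !(mulr0, mulr1, addr0, add0r) => -[[[-> ->]]].
rewrite !(mul0r, add0r) => -> ->.
by rewrite !raddf0 !row_mx0.
Qed.

Lemma common_kernel4 r1 r2 r3 r4 : (4 < n)%N -> exists2 u, u != 0 &
  [/\ dot u r1 = 0, dot u r2 = 0, dot u r3 = 0 & dot u r4 = 0].
Proof.
move=> n4; pose R : 'M[F]_(1 + 1 + (1 + 1), n) := col_mx (col_mx r1 r2) (col_mx r3 r4).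
have: kermx R^T != 0.
  rewrite kermx_eq0 /row_free mxrank_tr; apply/eqP => rn.
  by have := rank_leq_row R; rewrite rn leqNgt n4.
case/rowV0Pn=> u /sub_kermxP uR u0; exists u => //.
move: uR; rewrite !tr_col_mx !mul_mx_row -!row_mx0.
case/eq_row_mx=> /eq_row_mx[E1 E2] /eq_row_mx[E3 E4].
by rewrite /dot E1 E2 E3 E4 !mxE.
Qed.

Lemma two_cycle3 (B : 'rV[F]_n -> 'rV[F]_n -> Prop) r1 r2 r3 (z1 z2 z3 : F) :
    (forall e r, B e r -> dot e r = 0) ->
    (exists e, [/\ dot e r1 = z1, dot e r2 = z2 & dot e r3 = z3]) ->
    (forall e, dot e r1 = z1 -> dot e r2 = z2 -> dot e r3 = z3 ->
      exists2 r, B e r & forall t1 t2 t3, r != t1 *: r1 + t2 *: r2 + t3 *: r3) ->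
  exists e1 s1 e2 s2, [/\ B e1 s1, B e2 s2, dot e1 s2 != 0, dot e2 s1 != 0 &
    [/\ dot e1 r1 = z1, dot e1 r2 = z2, dot e1 r3 = z3 &
     [/\ dot e2 r1 = z1, dot e2 r2 = z2 & dot e2 r3 = z3]]].
Proof.
move=> B0 ex bad_ex.
pose Z : 'M[F]_(1 + 1 + 1, n) := col_mx (col_mx r1 r2) r3.
pose z : 'rV[F]_(1 + 1 + 1) := row_mx (row_mx z1%:M z2%:M) z3%:M.
have ZE e : e *m Z^T = row_mx (row_mx (dot e r1)%:M (dot e r2)%:M) (dot e r3)%:M.
  by rewrite !tr_col_mx !mul_mx_row !mulmx_dot.
have ZP e : e *m Z^T = z -> [/\ dot e r1 = z1, dot e r2 = z2 & dot e r3 = z3].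
  have inj1 : injective (fun a : F => a%:M : 'M_1).
    by move=> a b /(congr1 (fun M : 'M_1 => M 0 0)); rewrite !mxE.
  by rewrite ZE => /eq_row_mx[/eq_row_mx[/inj1 ? /inj1 ?] /inj1 ?].
have [||] := @two_cycle _ _ B _ Z z B0.
- by case: ex => e [E1 E2 E3]; exists e; rewrite ZE E1 E2 E3.
- move=> e /ZP[E1 E2 E3]; have [r Ber nr] := bad_ex e E1 E2 E3; exists r => //.
  apply/negP => /submxP[D]; rewrite -[D]hsubmxK -[lsubmx D]hsubmxK !mul_row_col.
  rewrite [lsubmx (_ _)]mx11_scalar [rsubmx (_ _)]mx11_scalar [rsubmx D]mx11_scalar.
  by rewrite !mul_scalar_mx => /eqP; apply/negP/nr.
move=> e1 [s1 [e2 [s2 [/ZP[? ? ?] /ZP[? ? ?] ? ? [? ?]]]]].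
by exists e1, s1, e2, s2.
Qed.

Definition all_bad S := forall e, e != 0 -> exists2 r, r != 0 & bad S e r.
Definition all_cobad S := forall r, r != 0 -> exists2 e, e != 0 & bad S e r.

Lemma all_bad_two_cycle S : (0 < n)%N -> all_bad S -> exists e1 r1 e2 r2,
  [/\ bad S e1 r1, bad S e2 r2, dot e1 r2 != 0 & dot e2 r1 != 0].
Proof.
move=> n0 allb; have [|||e1 [r1 [e2 [r2 [b1 b2 e12 e21 _]]]]] :=
  @two_cycle3 (bad S) 0 0 0 0 0 0; last by exists e1, r1, e2, r2.
- by move=> e s [].
- by exists 0; rewrite dot0l.
move=> e _ _ _; have [e0|e0] := eqVneq e 0; last first.
  have [r r0 br] := allb e e0; exists r => // t1 t2 t3.
  by rewrite !scaler0 !addr0.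
exists (const_mx 1); first by rewrite e0; split; rewrite ?tens0l ?mem0v ?dot0l.
move=> t1 t2 t3; rewrite !scaler0 !addr0; apply/rV0Pn.
by exists (Ordinal n0); rewrite mxE oner_neq0.
Qed.

End FewEigenvalues.

(** * Spaces all of whose vectors and covectors are bad, in characteristic 2 *)

Section DoublyBad.

Variables (F : fieldType) (x : F).
Hypotheses (h2 : 2%:R = 0 :> F) (x0 : x != 0) (x1 : x != 1).

Let X := x ^+ 2 + x.

Lemma char2_addr1_neq0 (y : F) : y != 1 -> y + 1 != 0.
Proof.
apply: contra_neq => y1; have -> : y = y + 1 - 2%:R + 1 by ring.
by rewrite y1 h2 subrr add0r.
Qed.

Lemma sqr_x_neq1 : 1 ^+ 2 != x ^+ 2.
Proof.
rewrite eq_sym -subr_eq0 subr_sqr mulf_neq0 ?subr_eq0 //.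
exact: char2_addr1_neq0.
Qed.

(** X + 1 and X are the values of c and p required by [spec2_tens3]; a, b and t are the factors of
    e1#r1, e2#r2 and p#r in [all_bad_n4]. *)
Lemma solve_first_aux (p1 p2 q1 q2 : F) : p2 * q1 != 0 ->
  exists a b t, a * b + t * (p1 * q1 + p2 * q2) = X + 1 /\
    t * (a * (p2 * q1) + b * (p1 * q2)) = X.
Proof.
move=> A0; pose C := p1 * q1 + p2 * q2; rewrite -/C.
have X0 : X != 0.
  by rewrite /X (_ : _ + x = x * (x + 1)) ?mulf_neq0 ?char2_addr1_neq0 //; ring.
have [B0|B0] := eqVneq (p1 * q2) 0.
  exists (X / (p2 * q1)), ((X + 1 - C) / (X / (p2 * q1))), 1.
  rewrite B0; move: X0 A0; rewrite mulf_eq0 negb_or => X0 /andP[p20 q10].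
  by split; field; rewrite ?p20 ?q10 ?X0.
move: (A0) (B0); rewrite !mulf_eq0 !negb_or => /andP[p20 q10] /andP[p10 q20].
have [X1|X1] := eqVneq X 1.
  have XE : X + 1 = 0 by rewrite X1 -h2; ring.
  have [C0|C0] := eqVneq C 0.
    exists 1, 0, (p2 * q1)^-1; rewrite C0 XE X1; split; first by ring.
    by field; rewrite p20 q10.
  exists (p1 / p2), (p2 / p1), C^-1; rewrite XE X1; split.
    by rewrite -h2; field; rewrite C0 p10 p20.
  by rewrite /C in C0 *; field; rewrite C0 p10 p20.
have X1' := char2_addr1_neq0 X1.
have [C0|C0] := eqVneq C 0; last first.
  exists (X / ((X + 1) / C * (p2 * q1))), 0, ((X + 1) / C).
  by split; field; rewrite ?p20 ?q10 ?C0 ?X1'.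
(* With C = 0 the first equation reads a b = X + 1. The pairs (1, X + 1) and (x, (X + 1) / x) cannot
   both annihilate the factor of t, as x^2 differs from 1. *)
have [E|E] := eqVneq (p2 * q1 + (X + 1) * (p1 * q2)) 0; last first.
  exists 1, (X + 1), (X / (p2 * q1 + (X + 1) * (p1 * q2))).
  by rewrite C0; split; field.
have E' : x ^+ 2 * (p2 * q1) + (X + 1) * (p1 * q2) != 0.
  have -> : x ^+ 2 * (p2 * q1) + (X + 1) * (p1 * q2) =
    (x - 1) * (x + 1) * (p2 * q1) + (p2 * q1 + (X + 1) * (p1 * q2)) by ring.
  by rewrite E addr0 !mulf_neq0 ?subr_eq0 ?char2_addr1_neq0.
exists x, ((X + 1) / x), (X * x / (x ^+ 2 * (p2 * q1) + (X + 1) * (p1 * q2))).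
by rewrite C0; split; field; rewrite ?x0 ?E'.
Qed.

Lemma solve_first (p1 p2 q1 q2 : F) : (p2 * q1 != 0) || (p1 * q2 != 0) ->
  exists a b t, a * b + t * (p1 * q1 + p2 * q2) = X + 1 /\
    t * (a * (p2 * q1) + b * (p1 * q2)) = X.
Proof.
case/orP; first exact: solve_first_aux.
move/(@solve_first_aux p2 p1 q2 q1) => [a [b [t [E1 E2]]]].
by exists b, a, t; rewrite mulrC [p1 * q1 + _]addrC [b * _ + _]addrC.
Qed.

(** The unknowns are those of [star_absurd], where an invertible [de] serves to realize w.
    Eliminating w leaves, with N = be b + de c, the equation (N - a^2) al = X - a (X + 1) + a N. *)
Lemma solve_second (a b c : F) : [|| a != 0, b != 0 | c != 0] ->
  exists al be de w, [/\ de != 0, w + a * al + (be * b + de * c) = X + 1 &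
    (be * b + de * c) * al + a * w = X].
Proof.
move=> abc; have [b0|b0] := eqVneq b 0; last first.
  (* With al = a + 1, N occurs with coefficient 1, and b != 0 lets [be] give it the required
     value. *)
  pose be := (X - c * (a + 1) - a * (X + 1) + a ^+ 2 * (a + 1) + a * c) / b.
  exists (a + 1), be, 1, (X + 1 - a * (a + 1) - b * be - c).
  by rewrite oner_neq0 /be; split=> //; field.
(* If de = 1 and de = x both failed, then c = a^2 = x c, so c = a = 0. *)
have [de de0 dc] : exists2 de, de != 0 & de * c - a ^+ 2 != 0.
  have [c1|c1] := eqVneq (1 * c - a ^+ 2) 0; last by exists 1; rewrite ?oner_neq0.
  exists x => //; apply/eqP => cx; move: abc; rewrite b0 eqxx /=.
  have /eqP : (x - 1) * c = 0.
    by rewrite -[RHS]subr0 -{1}cx -c1; ring.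
  rewrite mulf_eq0 subr_eq0 (negPf x1) /= => /eqP c0.
  have a0 : a = 0.
    by apply/eqP; rewrite -sqrf_eq0 -oppr_eq0 -(add0r (- _)) -{1}(mulr0 x) -{1}c0 cx.
  by rewrite a0 c0 eqxx.
pose al := (X - a * (X + 1) + a * de * c) / (de * c - a ^+ 2).
exists al, 0, de, (X + 1 - a * al - de * c).
by rewrite b0 /al; split=> //; field.
Qed.

Variable n : nat.
Implicit Types (e r u v : 'rV[F]_n) (S : {vspace 'M[F]_n}).

(** After rescaling, [pair_eigenvalues] applies with the values 1 and x; the last clause serves to
    exhibit a third eigenvalue 0. *)
Lemma bad_pair S e1 r1 e2 r2 f1 s1 f2 s2 :
    bad S e1 r1 -> bad S e2 r2 -> dot e1 r2 != 0 -> dot e2 r1 != 0 ->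
    bad S f1 s1 -> bad S f2 s2 -> dot f1 s2 != 0 -> dot f2 s1 != 0 ->
    dot f1 r1 = 0 -> dot f1 r2 = 0 -> dot f2 r1 = 0 -> dot f2 r2 = 0 ->
  (4 <= n)%N /\ exists M, [/\ M \in S, eigenvalue M 1, eigenvalue M x &
    forall u, dot u r1 = 0 -> dot u r2 = 0 -> dot u s1 = 0 -> dot u s2 = 0 ->
      u *m M = 0].
Proof.
move=> b1 b2 e12 e21 b3 b4 f12 f21 fr11 fr12 fr21 fr22.
have [T1 D1] := badZ (dot e2 r1)^-1 b1; have [T2 D2] := badZ (dot e1 r2)^-1 b2.
have [T3 D3] := badZ (dot f2 s1)^-1 b3; have [T4 D4] := badZ (dot f1 s2)^-1 b4.
have E12 : dot e1 ((dot e1 r2)^-1 *: r2) = 1 by rewrite dotZr mulVf.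
have E21 : dot e2 ((dot e2 r1)^-1 *: r1) = 1 by rewrite dotZr mulVf.
have F12 : dot f1 ((dot f1 s2)^-1 *: s2) = 1 by rewrite dotZr mulVf.
have F21 : dot f2 ((dot f2 s1)^-1 *: s1) = 1 by rewrite dotZr mulVf.
have G r a u : dot u r = 0 -> dot u (a *: r) = 0 by move=> ur; rewrite dotZr ur mulr0.
have G1 := G _ (dot e2 r1)^-1 _ fr11; have G2 := G _ (dot e1 r2)^-1 _ fr12.
have G3 := G _ (dot e2 r1)^-1 _ fr21; have G4 := G _ (dot e1 r2)^-1 _ fr22.
split; first exact: (pair_free D1 D2 E12 E21 D3 D4 F12 F21 G1 G2 G3 G4).
have pe := pair_eigenvalues D1 D2 E12 E21 D3 D4 F12 F21 G1 G2 G3 G4 sqr_x_neq1.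
case: pe; set M := (M in eigenvalue M _) => M1 Mx; exists M; split=> //.
  by rewrite memvD // memvZ // memvD.
move=> u u1 u2 u3 u4; rewrite /M mulmxDr -!scalemxAr !mulmxDr !mul_tens.
by rewrite !(G _ _ u) // !(scale0r, addr0, scaler0).
Qed.

(** The pair gives the eigenvalues 1 and x; for n > 4 the four covectors have a common kernel
    vector, which adds the eigenvalue 0. *)
Lemma triangular_pair S e1 r1 e2 r2 f1 s1 f2 s2 : spec2 S ->
    bad S e1 r1 -> bad S e2 r2 -> dot e1 r2 != 0 -> dot e2 r1 != 0 ->
    bad S f1 s1 -> bad S f2 s2 -> dot f1 s2 != 0 -> dot f2 s1 != 0 ->
    dot f1 r1 = 0 -> dot f1 r2 = 0 -> dot f2 r1 = 0 -> dot f2 r2 = 0 ->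
  n = 4%N /\ ~ spec1 S.
Proof.
move=> S2 b1 b2 e12 e21 b3 b4 f12 f21 fr11 fr12 fr21 fr22.
have [n4 [M [MS M1 Mx kM]]] :=
  bad_pair b1 b2 e12 e21 b3 b4 f12 f21 fr11 fr12 fr21 fr22.
split; last first.
  by move=> S1; case/eqP: x1; apply: (S1 M) => //; apply: oner_neq0.
apply/eqP; rewrite eqn_leq n4 andbT leqNgt; apply/negP => n5.
have [u u0 [u1 u2 u3 u4]] := common_kernel4 r1 r2 s1 s2 n5.
have M0 : eigenvalue M 0.
  by apply/eigenvalueP; exists u; rewrite ?scale0r ?kM.
have := S2 _ _ _ _ MS M0 M1 Mx.
by rewrite /= !inE eq_sym oner_eq0 (eq_sym 0) (negPf x0) (eq_sym 1) x1.
Qed.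

(** A vector v with <v, r1> = <v, r2> = 1 and <v, r> = 0 has only witnesses killing e1, e2 and f,
    hence, when nonzero, outside the span of r1, r2, r. A greedy choice among such v yields a second
    cycle, and f is in the kernel of the resulting matrix: eigenvalues 0, 1, x. *)
Lemma star_absurd S e1 e2 f r1 r2 r : spec2 S -> all_bad S ->
    dot e1 r1 = 0 -> dot e1 r2 = 1 -> dot e1 r = 0 ->
    dot e2 r1 = 1 -> dot e2 r2 = 0 -> dot e2 r = 0 ->
    dot f r1 = 0 -> dot f r2 = 0 -> dot f r = 1 ->
    tens e1 r1 \in S -> tens e2 r2 \in S -> tens e1 r \in S -> tens f r2 \in S ->
  False.
Proof.
move=> S2 allb e11 e12 e1r e21 e22 e2r f1 f2 fr T11 T22 T1r Tf2.
have vanish v s : dot v r1 = 1 -> dot v r2 = 1 -> dot v r = 0 -> bad S v s ->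
    [/\ dot e1 s = 0, dot e2 s = 0 & dot f s = 0].
  move=> v1 v2 vr [Tvs vs].
  suff: ~~ [|| dot e1 s != 0, dot e2 s != 0 | dot f s != 0].
    by rewrite !negb_or !negbK => /and3P[/eqP-> /eqP-> /eqP->].
  apply/negP => /solve_second[al [be [de [w [de0 cE pE]]]]].
  (* [ga] makes <be e2 + de f, al r1 + ga r> equal to w. *)
  pose ga := (w - al * be) / de.
  have wE : be * al + de * ga = w by rewrite /ga; field.
  have := @spec2_tens3 _ _ S e1 (be *: e2 + de *: f) v (al *: r1 + ga *: r) r2 s x
    h2 S2; rewrite !dotE e11 e12 e1r e21 e22 e2r f1 f2 fr v1 v2 vr vs.
  rewrite !(mulr0, mulr1, addr0, add0r, mul1r) wE.
  by apply=> //; rewrite !tensDl !tensDr !tensZl !tensZr !(memvD, memvZ).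
have [|||v1 [s1 [v2 [s2 [b1 b2 d12 d21 [E1 E2 E3 [E4 E5 E6]]]]]]] :=
  @two_cycle3 _ _ (bad S) r1 r2 r 1 1 0.
- by move=> e s [].
- by exists (e1 + e2); rewrite !dotE e11 e12 e1r e21 e22 e2r !(addr0, add0r).
- move=> v v1 v2 vr; have [|s s0 bs] := allb v.
    by apply: contra_neq (oner_neq0 F) => v0; rewrite -v1 v0 dot0l.
  exists s => // t1 t2 t3; have [V1 V2 V3] := vanish v s v1 v2 vr bs.
  apply: contra_neq s0 => sE; move: V1 V2 V3; rewrite sE !dotE.
  rewrite e11 e12 e1r e21 e22 e2r f1 f2 fr !(mulr0, mulr1, addr0, add0r).
  by move=> -> -> ->; rewrite !scale0r !addr0.
have [V1 V2 V3] := vanish _ _ E1 E2 E3 b1.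
have [V4 V5 V6] := vanish _ _ E4 E5 E6 b2.
have e12' : dot e1 r2 != 0 by rewrite e12 oner_neq0.
have e21' : dot e2 r1 != 0 by rewrite e21 oner_neq0.
have [_ [M [MS M1 Mx kM]]] := bad_pair b1 b2 d12 d21 (conj T11 e11) (conj T22 e22)
  e12' e21' V1 V4 V2 V5.
have M0 : eigenvalue M 0.
  apply/eigenvalueP; exists f; first by rewrite scale0r kM.
  by apply: contra_neq (oner_neq0 F) => f0; rewrite -fr f0 dot0l.
have := S2 _ _ _ _ MS M0 M1 Mx.
by rewrite /= !inE eq_sym oner_eq0 (eq_sym 0) (negPf x0) (eq_sym 1) x1.
Qed.

(** A second cycle, triangular with respect to the first, is sought among the f killed by r1 and r2,
    then among the covectors r killing e1 and e2 with <f, r> = 1. If both searches fail, S contains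
    f#s with s in the span of r1, r2 and p#r with p in the span of e1, e2, which is
    contradictory. *)
Lemma all_bad_n4 S : (3 <= n)%N -> spec2 S -> all_bad S -> all_cobad S ->
  n = 4%N /\ ~ spec1 S.
Proof.
move=> n3 S2 allb allc.
have outside r1 r2 : exists r, forall t1 t2 t3,
    r != t1 *: r1 + t2 *: r2 + t3 *: (0 : 'rV[F]_n).
  pose R : 'M[F]_(1 + 1, n) := col_mx r1 r2.
  have [i Ri] : exists i, ~~ (row i 1%:M <= R)%MS.
    apply/existsP; rewrite -negb_forall; apply/negP => /forallP/row_subP sR.
    by have := leq_trans (mxrankS sR) (rank_leq_row R); rewrite mxrank1 leqNgt n3.
  exists (row i 1%:M) => t1 t2 t3; apply: contra Ri => /eqP->.
  apply/submxP; exists (row_mx t1%:M t2%:M).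
  by rewrite mul_row_col !mul_scalar_mx scaler0 addr0.
have [e1 [r1 [e2 [r2 [b1 b2 e12 e21]]]]] := all_bad_two_cycle (ltnW (ltnW n3)) allb.
wlog [{}e12 {}e21] : r1 r2 b1 b2 e12 e21 / dot e1 r2 = 1 /\ dot e2 r1 = 1.
  move=> /(_ ((dot e2 r1)^-1 *: r1) ((dot e1 r2)^-1 *: r2)).
  have E12 : dot e1 ((dot e1 r2)^-1 *: r2) = 1 by rewrite dotZr mulVf.
  have E21 : dot e2 ((dot e2 r1)^-1 *: r1) = 1 by rewrite dotZr mulVf.
  by apply; rewrite ?E12 ?E21 ?oner_neq0 //; apply: badZ.
have [T1 e11] := b1; have [T2 e22] := b2.
have e12' : dot e1 r2 != 0 by rewrite e12 oner_neq0.
have e21' : dot e2 r1 != 0 by rewrite e21 oner_neq0.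
have [goodf|nogoodf] := classic (exists2 f, dot f r1 = 0 /\ dot f r2 = 0 &
  forall s, bad S f s -> exists t1 t2, s = t1 *: r1 + t2 *: r2); last first.
  have [|||f1 [s1 [f2 [s2 [b3 b4 f12 f21 [E1 E2 _ [E3 E4 _]]]]]]] :=
    @two_cycle3 _ _ (bad S) r1 r2 0 0 0 0.
  - by move=> e s [].
  - by exists 0; rewrite !dot0l.
  - move=> f f1 f2 _; apply: NNPP => no; case: nogoodf; exists f => // s bs.
    apply: NNPP => no'; case: no; exists s => // t1 t2 t3.
    by apply/eqP=> sE; case: no'; exists t1, t2; rewrite sE scaler0 addr0.
  exact: (triangular_pair S2 b1 b2 e12' e21' b3 b4 f12 f21).
case: goodf => f [f1 f2] goodf.
(* For f = 0 every covector is a witness, but r1 and r2 do not span, as n >= 3. *)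
have f0 : f != 0.
  apply/eqP => f0; have [r nr] := outside r1 r2.
  have [|t1 [t2 rE]] := goodf r.
    by rewrite f0; split; rewrite ?tens0l ?mem0v ?dot0l.
  by have := nr t1 t2 0; rewrite rE scaler0 addr0 eqxx.
have [goodr|nogoodr] := classic (exists2 r,
  [/\ dot e1 r = 0, dot e2 r = 0 & dot f r = 1] &
  forall c, bad S c r -> exists t1 t2 t3, c = t1 *: e1 + t2 *: e2 + t3 *: f);
  last first.
  have [|||r3 [c3 [r4 [c4 [b3 b4 c34 c43 [E1 E2 _ [E3 E4 _]]]]]]] :=
    @two_cycle3 _ _ (fun r c => bad S c r) e1 e2 f 0 0 1.
  - by move=> r c [_]; rewrite dotC.
  - have [r fr] := neq0_dot f0.
    exists (r - dot e1 r *: r2 - dot e2 r *: r1).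
    rewrite -!scaleNr; rewrite !(dotC _ e1) !(dotC _ e2) !(dotC _ f) !dotE.
    by rewrite e11 e12 e21 e22 f1 f2 fr; split; ring.
  - move=> r rE1 rE2 rE3; apply: NNPP => no; case: nogoodr.
    exists r; first by rewrite !(dotC _ r).
    move=> c bc; apply: NNPP => no'; case: no; exists c => // t1 t2 t3.
    by apply/eqP=> cE; case: no'; exists t1, t2, t3.
  rewrite dotC in c34; rewrite dotC in c43.
  rewrite dotC in E1; rewrite dotC in E2; rewrite dotC in E3; rewrite dotC in E4.
  (* The original cycle is now the second one, since r3 and r4 kill e1 and e2. *)
  exact: (triangular_pair S2 b3 b4 c43 c34 b1 b2 e12' e21').
case: goodr => r [e1r e2r fr] goodr; exfalso.
have [s s0 bs] := allb f f0; have [t1 [t2 sE]] := goodf s bs.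
have r0 : r != 0 by apply: contra_neq (oner_neq0 F) => r0; rewrite -fr r0 dot0r.
have [p p0 bp] := allc r r0; have [p1 [p2 [p3 pE]]] := goodr p bp.
have p30 : p3 = 0.
  by case: bp => _; rewrite pE !dotE e1r e2r fr !(mulr0, mulr1, add0r).
move: pE; rewrite p30 scale0r addr0 => {p3 p30} pE.
case: bp bs => Tp _ [Ts _].
have : ~~ ((p2 * t2 != 0) || (p1 * t1 != 0)).
  apply/negP => /solve_first[a [b [t [cE pE']]]].
  (* The first two summands need not be in S separately; their sum is a e1#r1 + b e2#r2 + t p#r. *)
  have := @spec2_tens3 _ _ S e1 e2 f (a *: r1 + (t * p1) *: r)
    (b *: r2 + (t * p2) *: r) s x h2 S2.
  rewrite sE !dotE e11 e12 e1r e21 e22 e2r f1 f2 fr !(mulr0, mulr1, addr0, add0r).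
  apply=> //.
  - have -> : tens e1 (a *: r1 + (t * p1) *: r) + tens e2 (b *: r2 + (t * p2) *: r)
      = a *: tens e1 r1 + b *: tens e2 r2 + t *: tens p r.
      rewrite pE !tensDr tensDl !tensZr !tensZl scalerDr !scalerA.
      by rewrite addrACA.
    by rewrite -sE !(memvD, memvZ).
  - by rewrite -/X -cE; ring.
  - by rewrite -/X -pE'; ring.
rewrite negb_or !negbK !mulf_eq0 => /andP[c1 c2].
(* Either p is a multiple of e2 and s of r1, or p of e1 and s of r2; exchanging the indices
   identifies the two cases. *)
have [p10|p10] := eqVneq p1 0.
  have p20 : p2 != 0.
    by apply: contra_neq p0 => p20; rewrite pE p10 p20 !scale0r addr0.
  move: c1; rewrite (negPf p20) /= => /eqP t20.
  have t10 : t1 != 0.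
    by apply: contra_neq s0 => t10; rewrite sE t10 t20 !scale0r addr0.
  move: Tp Ts; rewrite pE sE p10 t20 !scale0r addr0 add0r tensZl tensZr.
  rewrite !rpredZeq (negPf p20) (negPf t10) /= => Tp Ts.
  exact: (star_absurd S2 allb e22 e21 e2r e12 e11 e1r f2 f1 fr T2 T1 Tp Ts).
move: c2; rewrite (negPf p10) /= => /eqP t10.
have t20 : t2 != 0.
  by apply: contra_neq s0 => t20; rewrite sE t10 t20 !scale0r addr0.
move: c1; rewrite (negPf t20) orbF => /eqP p20.
move: Tp Ts; rewrite pE sE p20 t10 !scale0r addr0 add0r tensZl tensZr.
rewrite !rpredZeq (negPf p10) (negPf t20) /= => Tp Ts.
exact: (star_absurd S2 allb e11 e12 e1r e21 e22 e2r f1 f2 fr T1 T2 Tp Ts).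
Qed.

End DoublyBad.

(** * Transposition, passage to V / Fe and change of basis *)

Section Reduction.

Variable F : fieldType.

Definition eig_sub n (S' S : {vspace 'M[F]_n}) := forall M', M' \in S' ->
  exists2 M, M \in S & forall a, eigenvalue M' a -> eigenvalue M a.

Lemma eig_sub_spec2 n (S' S : {vspace 'M[F]_n}) :
  eig_sub S' S -> spec2 S -> spec2 S'.
Proof.
move=> sub S2 M' a b c /sub[M MS eM] /eM Ma /eM Mb /eM Mc.
exact: (S2 M).
Qed.

Lemma eig_sub_spec1 n (S' S : {vspace 'M[F]_n}) :
  eig_sub S' S -> spec1 S -> spec1 S'.
Proof.
move=> sub S1 M' a b /sub[M MS eM] a0 b0 /eM Ma /eM Mb.
exact: (S1 M).
Qed.

Lemma eig_sub_spec0 n (S' S : {vspace 'M[F]_n}) :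
  eig_sub S' S -> spec0 S -> spec0 S'.
Proof. by move=> sub S0 M' a /sub[M MS eM] /eM Ma; apply: (S0 M). Qed.

Definition tr_space n (S : {vspace 'M[F]_n}) : {vspace 'M[F]_n} :=
  (linfun (@trmx F n n) @: S)%VS.

Lemma mem_tr_space n (S : {vspace 'M[F]_n}) M : (M \in tr_space S) = (M^T \in S).
Proof.
apply/memv_imgP/idP => [[N NS ->]|MS]; first by rewrite lfunE /= trmxK.
by exists M^T; rewrite // lfunE /= trmxK.
Qed.

Lemma dim_tr_space n (S : {vspace 'M[F]_n}) : \dim (tr_space S) = \dim S.
Proof.
apply: limg_dim_eq; apply/eqP; rewrite -subv0; apply/subvP => M.
rewrite memv_cap memv_ker lfunE /= memv0 => /andP[_ /eqP M0].
by rewrite -(trmxK M) M0 trmx0.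
Qed.

Lemma eig_sub_tr n (S : {vspace 'M[F]_n}) : eig_sub (tr_space S) S.
Proof.
move=> M; rewrite mem_tr_space => MS; exists M^T => // a.
by rewrite eigenvalue_tr.
Qed.

Lemma bad_tr n (S : {vspace 'M[F]_n}) e r : bad (tr_space S) e r <-> bad S r e.
Proof. by rewrite /bad mem_tr_space tr_tens dotC. Qed.

(** The full matrix space contains a diagonal matrix with eigenvalues 1 and x. For n = 2 this is the
    base case of [dim_spec1]. *)
Lemma spec1_proper n (x : F) (S : {vspace 'M[F]_n}) : x != 0 -> x != 1 ->
  (2 <= n)%N -> spec1 S -> (\dim S < n ^ 2)%N.
Proof.
move=> x0 x1; case: n S => [|[|n]] S // _ S1.
have -> : (n.+2 ^ 2 = \dim {: 'M[F]_n.+2})%N by rewrite dimvf dim_matrix expnS expn1.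
rewrite ltnNge; apply: contra x1 => dS.
have SE : S = fullv by apply/eqP; rewrite eqEdim subvf.
pose d : 'rV[F]_n.+2 := \row_j (if j == 0 then 1 else x).
have ev i : eigenvalue (diag_mx d) (d 0 i).
  apply/eigenvalueP; exists (delta_mx 0 i); first by rewrite -rowE row_diag_mx.
  by apply/rV0Pn; exists i; rewrite mxE !eqxx oner_neq0.
have := ev 0; have := ev 1; rewrite !mxE /= => ex e1.
by apply/eqP; apply: (S1 (diag_mx d)); rewrite ?SE ?memvf ?oner_neq0.
Qed.

Variable m : nat.
Implicit Types S : {vspace 'M[F]_(1 + m)}.

Definition e0 : 'rV[F]_(1 + m) := row_mx 1%:M 0.

Lemma e0_neq0 : e0 != 0.
Proof. by rewrite row_mx_eq0 negb_and -scalemx1 scale1r oner_eq0. Qed.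

Lemma mul_e0 (M : 'M[F]_(1 + m)) : e0 *m M = usubmx M.
Proof. by rewrite -[M in LHS]vsubmxK mul_row_col mul1mx mul0mx addr0. Qed.

(** For e = [e0], [top_space] is e S, [top_ker] the matrices of S killing e, [corner] their action
    on V / Fe, and [line_space] the matrices e#r of S with <e, r> = 0. *)
Definition top_space S := (linfun (@usubmx F 1 m (1 + m)) @: S)%VS.
Definition top_ker S := (S :&: lker (linfun (@usubmx F 1 m (1 + m))))%VS.

Definition corner (M : 'M[F]_(1 + m)) : 'M[F]_m := drsubmx M.
Fact corner_linear : linear corner.
Proof. by move=> a A B; rewrite /corner /drsubmx !linearP. Qed.
HB.instance Definition _ := GRing.isLinear.Build F _ _ _ corner corner_linear.

Definition quot_space S := (linfun corner @: top_ker S)%VS.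
Definition line_space S := (top_ker S :&: lker (linfun corner))%VS.

Lemma dim_reduction S :
  \dim S = (\dim (top_space S) + \dim (quot_space S) + \dim (line_space S))%N.
Proof.
have dS := limg_ker_dim (linfun (@usubmx F 1 m (1 + m))) S.
have dK := limg_ker_dim (linfun corner) (top_ker S).
rewrite -dS -[(S :&: _)%VS]/(top_ker S) -dK.
rewrite -/(quot_space S) -/(line_space S) -/(top_space S).
by rewrite addnC (addnC (\dim (line_space S))) addnA.
Qed.

Lemma dim_top_space S : (\dim (top_space S) <= m.+1)%N.
Proof. by rewrite (leq_trans (dimvS (subvf _))) // dimvf /dim /= mul1n. Qed.

Lemma quot_spaceP S (A : 'M[F]_m) : reflect
  (exists c, block_mx 0 0 c A \in S) (A \in quot_space S).
Proof.
apply: (iffP memv_imgP) => [[M]|[c MS]].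
  rewrite memv_cap memv_ker !lfunE /= => /andP[MS /eqP Mu] ->.
  exists (dlsubmx M); suff <- : M = block_mx 0 0 (dlsubmx M) (corner M) by [].
  rewrite /corner -[LHS](@submxK F 1 m 1 m) /ulsubmx /ursubmx Mu.
  by rewrite !linear0.
exists (block_mx 0 0 c A); last by rewrite lfunE /= /corner block_mxKdr.
by rewrite memv_cap MS memv_ker lfunE /= /block_mx col_mxKu row_mx0.
Qed.

Lemma line_spaceP S M : M \in line_space S ->
  exists2 r, M = tens e0 r & bad S e0 r.
Proof.
rewrite !memv_cap !memv_ker !lfunE /= => /andP[/andP[MS /eqP Mu] /eqP Mc].
have ME : M = tens e0 (row_mx 0 (dlsubmx M)^T).
  rewrite /tens tr_row_mx trmx0 trmxK mul_col_row !mulmx0 !mulmx1.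
  rewrite -[LHS](@submxK F 1 m 1 m) /ulsubmx /ursubmx Mu !linear0.
  by move: Mc; rewrite /corner => ->.
exists (row_mx 0 (dlsubmx M)^T) => //; split; first by rewrite -ME.
by rewrite /dot tr_row_mx mul_row_col trmx0 mulmx0 mul0mx addr0 mxE.
Qed.

Lemma line_space0 S : (forall r, bad S e0 r -> r = 0) -> \dim (line_space S) = 0%N.
Proof.
move=> good; apply/eqP; rewrite dimv_eq0 -subv0; apply/subvP => M.
by case/line_spaceP => r -> /good->; rewrite tens0r mem0v.
Qed.

Definition very_bad n (S : {vspace 'M[F]_n}) e := exists r s,
  [/\ bad S e r, bad S e s & forall a b, a *: r + b *: s = 0 -> a = 0 /\ b = 0].

Lemma line_space1 S : ~ very_bad S e0 -> (\dim (line_space S) <= 1)%N.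
Proof.
move=> nvb; rewrite leqNgt; apply/negP => d2; apply: nvb.
have := vbasisP (line_space S); move: (vbasis _) d2 => X d2 XP.
have X0 := ltnW d2; pose i0 := Ordinal X0; pose i1 := Ordinal d2.
have XS i : X`_(nat_of_ord (i : 'I_(\dim (line_space S)))) \in line_space S.
  by apply: (basis_mem XP); rewrite mem_nth // size_tuple.
have [r rE br] := line_spaceP (XS i0); have [s sE bs] := line_spaceP (XS i1).
exists r, s; split=> // a b ab.
have /freeP/(_ (fun i => if i == i0 then a else if i == i1 then b else 0)) :=
  basis_free XP.
rewrite (bigD1 i0) //= (bigD1 i1) //= big1 => [|i /andP[/negPf-> /negPf->]];
  last by rewrite scale0r.
rewrite addr0 rE sE -!tensZr -tensDr ab tens0r => /(_ erefl) k0.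
by have := k0 i0; have := k0 i1; rewrite !eqxx.
Qed.

(** An eigenvector y of A lifts to (z, y) with z = y c / (a - b), b being the entry of c0. *)
Lemma eigenvalue_quot (c : 'M[F]_(m, 1)) (c0 : 'M[F]_1) A a :
  a != c0 0 0 -> eigenvalue A a -> eigenvalue (block_mx c0 0 c A) a.
Proof.
rewrite [c0]mx11_scalar mxE eqxx mulr1n; move: (c0 0 0) => b ab.
case/eigenvalueP=> y yA y0; apply/eigenvalueP.
exists (row_mx ((a - b)^-1 *: (y *m c)) y); last first.
  by rewrite row_mx_eq0 negb_and y0 orbT.
rewrite mul_row_block mulmx0 add0r yA scale_row_mx; congr row_mx.
rewrite mul_mx_scalar !scalerA -[X in _ + X]scale1r -scalerDl.
by congr (_ *: _); field; rewrite subr_eq0.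
Qed.

Lemma quot_spec0 S : spec0 S -> spec0 (quot_space S).
Proof.
move=> S0 A a /quot_spaceP[c cS] Aa; have [//|a0] := eqVneq a 0.
by apply: (S0 _ _ cS); apply: eigenvalue_quot; rewrite ?mxE.
Qed.

Lemma quot_spec1 S : spec1 S -> spec1 (quot_space S).
Proof.
move=> S1 A a b /quot_spaceP[c cS] a0 b0 Aa Ab.
by apply: (S1 _ _ _ cS) => //; apply: eigenvalue_quot; rewrite ?mxE.
Qed.

Lemma quot_spec2 S : spec2 S -> spec1 (quot_space S).
Proof.
move=> S2 A a b /quot_spaceP[c cS] a0 b0 Aa Ab; apply/eqP/negPn/negP => ab.
have ev0 : eigenvalue (block_mx 0 0 c A : 'M_(1 + m)) 0.
  apply/eigenvalueP; exists e0; last exact: e0_neq0.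
  by rewrite mul_e0 /block_mx col_mxKu row_mx0 scale0r.
have ev d : d != 0 -> eigenvalue A d -> eigenvalue (block_mx 0 0 c A : 'M_(1 + m)) d.
  by move=> d0 Ad; apply: eigenvalue_quot; rewrite ?mxE.
apply/(negP (S2 _ _ _ _ cS ev0 (ev _ a0 Aa) (ev _ b0 Ab))).
by rewrite /= !inE !(eq_sym 0) (negPf a0) (negPf b0) ab.
Qed.

Lemma top_space_e0 S c A (a : F) : block_mx 1%:M 0 c A \in S -> spec1 S ->
  forall B b, B \in quot_space S -> a != 0 -> eigenvalue (a *: A + B) b ->
  b = 0 \/ b = a.
Proof.
move=> MS S1 B b /quot_spaceP[d dS] a0 ev.
have [|b0] := eqVneq b 0; first by left.
have [|ba] := eqVneq b a; first by right.
right; pose N : 'M[F]_(1 + m) := block_mx a%:M 0 (a *: c + d) (a *: A + B).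
have NS : N \in S.
  have -> : N = a *: block_mx 1%:M 0 c A + block_mx 0 0 d B.
    by rewrite scale_block_mx add_block_mx !scaler0 !addr0 scalemx1.
  by rewrite memvD // memvZ.
apply: (S1 N) => //; first by apply: eigenvalue_quot; rewrite // mxE eqxx.
apply/eigenvalueP; exists e0; last exact: e0_neq0.
by rewrite mul_e0 /N /block_mx col_mxKu scale_row_mx scalemx1 scaler0.
Qed.

Lemma conj_e0 (e : 'rV[F]_(1 + m)) : e != 0 -> exists2 g, g \in unitmx & e0 *m g = e.
Proof.
move=> ne0; have [c ce] : exists c, e = c *: (e0 *m row_ebase e) /\ c != 0.
  have rk : \rank e = 1%N by rewrite rank_rV ne0.
  have := col_ebase_unit e; have := mulmx_ebase e; rewrite rk.
  rewrite [col_ebase e]mx11_scalar; move: (col_ebase e 0 0) => c ce.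
  rewrite unitmxE det_scalar1 unitfE => c0; exists c; split=> //.
  rewrite -[LHS]ce mul_scalar_mx.
  rewrite -scalemxAl; congr (_ *: (_ *m _)).
  by rewrite pid_mx_row.
case: ce => ce c0; exists (c *: row_ebase e); last by rewrite -scalemxAr -ce.
by rewrite unitmxZ ?row_ebase_unit // unitfE.
Qed.

Lemma move_to_e0 S (e : 'rV[F]_(1 + m)) : e != 0 -> exists S', [/\ \dim S' = \dim S, eig_sub S' S &
  exists2 h, h \in unitmx & forall r, bad S' e0 r -> bad S e (r *m h)].
Proof.
case/conj_e0=> g gU ge; pose f (M : 'M[F]_(1 + m)) := g *m M *m invmx g.
have f_lin : linear f.
  by move=> a A B; rewrite /f mulmxDr mulmxDl -scalemxAr -scalemxAl.
pose fM := GRing.isLinear.Build F _ _ _ f f_lin.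
pose fL : {linear 'M[F]_(1 + m) -> 'M[F]_(1 + m)} := HB.pack f fM.
exists (linfun fL @: S)%VS; split.
- apply: limg_dim_eq; apply/eqP; rewrite -subv0; apply/subvP => M.
  rewrite memv_cap memv_ker lfunE /= memv0 /f => /andP[_ /eqP M0].
  by rewrite -(mulKmx gU M) -(mulmxKV gU (g *m M)) M0 mul0mx mulmx0.
- move=> _ /memv_imgP[M MS ->]; exists M => // a; rewrite lfunE /= /f.
  case/eigenvalueP=> v vM v0; apply/eigenvalueP; exists (v *m g).
    have -> : v *m g *m M = v *m (g *m M *m invmx g) *m g.
      by rewrite !mulmxA mulmxKV.
    by rewrite vM scalemxAl.
  apply: contra v0 => /eqP vg; by rewrite -(mulmxK gU v) vg mul0mx.
exists (invmx g)^T; first by rewrite unitmx_tr unitmx_inv.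
move=> r [/memv_imgP[M MS]]; rewrite lfunE /= /f => ME er.
have gM : g *m M = tens e0 r *m g by rewrite ME mulmxKV.
have <- : e0 *m g = e by [].
have TE : tens (e0 *m g) (r *m (invmx g)^T) = M.
  rewrite /tens trmx_mul trmxK -mulmxA [r^T *m _]mulmxA -/(tens e0 r) -gM.
  by rewrite mulKmx.
split; first by rewrite TE.
by rewrite /dot trmx_mul trmxK -mulmxA (mulmxA g) mulmxV // mul1mx.
Qed.

End Reduction.

(** * Upper bounds for the dimension *)

Section Bounds.

Variable F : fieldType.

Lemma good_reduction m (S : {vspace 'M[F]_(1 + m)}) e : e != 0 ->
    (forall r, bad S e r -> r = 0) ->
  exists S' : {vspace 'M[F]_(1 + m)},
    [/\ \dim S' = \dim S, eig_sub S' S & \dim (line_space S') = 0%N].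
Proof.
move=> e0 good; have [S' [dS sub [h hU bh]]] := move_to_e0 S e0.
exists S'; split=> //; apply: line_space0 => r /bh/good rh.
by rewrite -(mulmxK hU r) rh mul0mx.
Qed.

Lemma not_very_bad_reduction m (S : {vspace 'M[F]_(1 + m)}) e : e != 0 ->
    ~ very_bad S e ->
  exists S' : {vspace 'M[F]_(1 + m)},
    [/\ \dim S' = \dim S, eig_sub S' S & (\dim (line_space S') <= 1)%N].
Proof.
move=> e0 nvb; have [S' [dS sub [h hU bh]]] := move_to_e0 S e0.
exists S'; split=> //; apply: line_space1 => -[r [s [br bs rs]]]; apply: nvb.
exists (r *m h), (s *m h); split=> [||a b ab]; [exact: bh | exact: bh |].
by apply: rs; rewrite -[LHS](mulmxK hU) mulmxDl -!scalemxAl ab mul0mx.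
Qed.

Lemma not_all_bad n (S : {vspace 'M[F]_n}) : ~ all_bad S ->
  exists2 e, e != 0 & forall r, bad S e r -> r = 0.
Proof.
move=> nab; apply: NNPP => no; apply: nab => e e0; apply: NNPP => no'.
case: no; exists e => // r br; apply/eqP/negPn/negP => r0.
by case: no'; exists r.
Qed.

Lemma not_all_cobad n (S : {vspace 'M[F]_n}) : ~ all_cobad S ->
  ~ all_bad (tr_space S).
Proof.
move=> nac ab; apply: nac => r /ab[e e0 /bad_tr be]; by exists e.
Qed.

Lemma doubly_bad_reduction m (S : {vspace 'M[F]_(1 + m)}) :
    ~ (all_bad S /\ all_cobad S) ->
  exists S' : {vspace 'M[F]_(1 + m)},
    [/\ \dim S' = \dim S, eig_sub S' S & \dim (line_space S') = 0%N].
Proof.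
move=> ndb; have [ab|/not_all_bad[e e0 ge]] := classic (all_bad S).
  have /not_all_cobad/not_all_bad[e e0 ge] : ~ all_cobad S by move=> ac; apply: ndb.
  have [S' [dS sub dl]] := good_reduction e0 ge.
  exists S'; split=> //; first by rewrite dS dim_tr_space.
  move=> M' /sub[M /eig_sub_tr[N NS eN] eM]; exists N => // a M'a.
  exact/eN/eM.
exact: good_reduction e0 ge.
Qed.

(** After rescaling a 2-cycle, e1 + e2 is an eigenvector for the eigenvalue 1. *)
Lemma spec0_all_bad n (S : {vspace 'M[F]_n.+1}) : spec0 S -> ~ all_bad S.
Proof.
move=> S0 /all_bad_two_cycle[//|e1 [r1 [e2 [r2 [b1 b2 e12 e21]]]]].
have [T1 D1] := badZ (dot e2 r1)^-1 b1; have [T2 D2] := badZ (dot e1 r2)^-1 b2.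
suff ev : eigenvalue (tens e1 ((dot e2 r1)^-1 *: r1)
                      + tens e2 ((dot e1 r2)^-1 *: r2)) 1.
  by have /eqP := S0 _ _ (memvD T1 T2) ev; rewrite oner_eq0.
apply/eigenvalueP; exists (e1 + e2).
  rewrite mulmxDr !mul_tens !dotDl D1 D2 !dotZr !mulVf // !(addr0, add0r).
  by rewrite !scale1r.
apply: contra_neq (oner_neq0 F) => e0.
by rewrite -(mulVf e21) -dotZr -[LHS]add0r -D1 -dotDl e0 dot0l.
Qed.

Lemma top_spaceP m (S : {vspace 'M[F]_(1 + m)}) : (m < \dim (top_space S))%N ->
  exists c A, block_mx 1%:M 0 c A \in S.
Proof.
move=> dt; have : e0 F m \in top_space S.
  suff -> : top_space S = fullv by rewrite memvf.
  by apply/eqP; rewrite eqEdim subvf dimvf /dim /= mul1n.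
case/memv_imgP=> M MS; rewrite lfunE /= => ME.
exists (dlsubmx M), (drsubmx M); suff <- : M = block_mx 1%:M 0 (dlsubmx M) (drsubmx M) by [].
by rewrite -[LHS](@submxK F 1 m 1 m) /ulsubmx /ursubmx -ME row_mxKl row_mxKr.
Qed.

Lemma dim_spec0 n (S : {vspace 'M[F]_n}) : spec0 S -> (\dim S <= 'C(n, 2))%N.
Proof.
elim: n S => [|m IHm] S S0.
  by rewrite (leq_trans (dimvS (subvf S))) // dimvf /dim.
have [|S' [dS sub dl]] := @doubly_bad_reduction m S.
  by case=> ab _; apply: spec0_all_bad S0 ab.
have S'0 := eig_sub_spec0 sub S0.
have dq := IHm _ (quot_spec0 S'0).
(* Otherwise some matrix of S' has first row [e0], hence the eigenvalue 1. *)
have dt : (\dim (top_space S') <= m)%N.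
  rewrite leqNgt; apply/negP => /top_spaceP[c [A MS]].
  suff ev : eigenvalue (block_mx 1%:M 0 c A : 'M_(1 + m)) 1.
    by have /eqP := S'0 _ _ MS ev; rewrite oner_eq0.
  apply/eigenvalueP; exists (e0 F m); last exact: e0_neq0.
  by rewrite mul_e0 /block_mx col_mxKu scale1r.
by rewrite -dS dim_reduction dl addn0 binS bin1 addnC leq_add.
Qed.

Variable x : F.
Hypotheses (h2 : 2%:R = 0 :> F) (x0 : x != 0) (x1 : x != 1).

Lemma spec1_doubly_bad n (S : {vspace 'M[F]_n}) : (3 <= n)%N -> spec1 S ->
  ~ (all_bad S /\ all_cobad S).
Proof.
move=> n3 S1 [ab ac].
by have [_] := all_bad_n4 h2 x0 x1 n3 (spec1_spec2 S1) ab ac; apply.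
Qed.

(* When S has first rows of every kind, it contains a matrix with first row e0 and
   corner A, and every a A + B with B in the quotient has its spectrum in {0, a}:
   either A enlarges the quotient without a second nonzero eigenvalue, or A lies in
   the quotient, which then has trivial spectrum. *)
Lemma dim_spec1 n (S : {vspace 'M[F]_n}) : (2 <= n)%N -> spec1 S ->
  (\dim S <= 'C(n, 2) + 2)%N.
Proof.
elim: n S => // m IHm S; rewrite ltnS => m1 S1.
have [m2|m2] := leqP 2 m; last first.
  have {m1 m2} mE : m = 1%N by apply/eqP; rewrite eqn_leq -ltnS m2 m1.
  by move: S S1; rewrite mE => S S1; have := spec1_proper x0 x1 (leqnn 2) S1.
have [|S' [dS sub dl]] := @doubly_bad_reduction m S.
  exact: spec1_doubly_bad.
have S'1 := eig_sub_spec1 sub S1.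
have qS1 := quot_spec1 S'1; have dq := IHm _ m2 qS1.
rewrite -dS dim_reduction dl addn0 binS bin1.
have [dt|dt] := leqP (\dim (top_space S')) m.
  by move: dt dq; move: (\dim (top_space S')) (\dim (quot_space S')) => ? ?; lia.
have [c [A MS]] := top_spaceP dt.
have dt' := dim_top_space S'.
suff dq' : (\dim (quot_space S') < 'C(m, 2) + 2)%N.
  by move: dt' dq'; move: (\dim (top_space S')) (\dim (quot_space S')) => ? ?; lia.
have [AQ|AQ] := boolP (A \in quot_space S').
  have Q0 : spec0 (quot_space S').
    move=> B b BQ Bb; apply/eqP/negPn/negP => b0.
    (* B = a A + (B - a A), so b is 0 or a; this is used for a = 1 and a = x. *)
    have shift (a : F) : a != 0 -> b = 0 \/ b = a.
      move=> a0; apply: (top_space_e0 MS S'1 (B := B - a *: A)) => //.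
        by rewrite memvB // memvZ.
      by rewrite addrC subrK.
    have [b'|b1] := shift 1 (oner_neq0 F); first by rewrite b' eqxx in b0.
    have [b'|bx] := shift x x0; first by rewrite b' eqxx in b0.
    by case/eqP: x1; rewrite -bx b1.
  by have := dim_spec0 Q0; rewrite addn2 ltnS => /leq_trans; apply; apply: leqW.
have Q'1 : spec1 (quot_space S' + <[A]>)%VS.
  move=> B a b /memv_addP[C CQ [D /vlineP[k ->] ->]] a0 b0 Ba Bb.
  have [k0|k0] := eqVneq k 0.
    by move: Ba Bb; rewrite k0 scale0r addr0 => Ba Bb; apply: (qS1 C).
  rewrite addrC in Ba Bb.
  case: (top_space_e0 MS S'1 CQ k0 Ba) => aE; first by rewrite aE eqxx in a0.
  case: (top_space_e0 MS S'1 CQ k0 Bb) => bE; first by rewrite bE eqxx in b0.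
  by rewrite aE bE.
(* The bound for the enlarged space makes the quotient one smaller, which offsets the first rows
   filling dimension m + 1. *)
have := IHm _ m2 Q'1; rewrite dimv_disjoint_sum; last first.
  apply/eqP; rewrite -subv0; apply/subvP => B; rewrite memv_cap memv0.
  case/andP=> BQ /vlineP[k BE]; move: BQ; rewrite BE rpredZeq (negPf AQ) orbF.
  by move/eqP->; rewrite scale0r.
by rewrite dim_vline (memPnC AQ) ?mem0v // addn1.
Qed.

(** Otherwise every vector and every covector has two independent witnesses. Some combination of two
    covector witnesses vanishes at [e0], and of two vector witnesses one is nonzero modulo [e0], so
    everything stays bad in the quotient of dimension 3, against [spec1_doubly_bad]. *)
Lemma spec2_n4_reduction (S : {vspace 'M[F]_(1 + 3)}) : spec2 S ->
  exists S' : {vspace 'M[F]_(1 + 3)},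
    [/\ \dim S' = \dim S, eig_sub S' S & (\dim (line_space S') <= 1)%N].
Proof.
move=> S2; have [vb|nvb] := classic (forall e, e != 0 -> very_bad S e); last first.
  have [e e_neq0 nvbe] : exists2 e, e != 0 & ~ very_bad S e.
    by apply: NNPP => no; apply: nvb => e e0; apply: NNPP => nv; apply: no; exists e.
  exact: not_very_bad_reduction nvbe.
have [vb'|nvb] := classic (forall e, e != 0 -> very_bad (tr_space S) e); last first.
  have [e e_neq0 nvbe] : exists2 e, e != 0 & ~ very_bad (tr_space S) e.
    by apply: NNPP => no; apply: nvb => e e0; apply: NNPP => nv; apply: no; exists e.
  have [S' [dS sub dl]] := not_very_bad_reduction e_neq0 nvbe.
  exists S'; split=> //; first by rewrite dS dim_tr_space.
  move=> M' /sub[M /eig_sub_tr[N NS eN] eM]; exists N => // a M'a.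
  exact/eN/eM.
have quotT (z : 'M[F]_1) (u v : 'rV[F]_3) :
    tens (row_mx z u) (row_mx 0 v) \in S -> tens u v \in quot_space S.
  move=> TS; apply/quot_spaceP; exists (v^T *m z).
  by move: TS; rewrite /tens tr_row_mx trmx0 mul_col_row !mul0mx.
have dotT (z z' : 'M[F]_1) (u v : 'rV[F]_3) :
    dot (row_mx z u) (row_mx z' v) = z 0 0 * z' 0 0 + dot u v.
  by rewrite /dot tr_row_mx mul_row_col mxE [z'^T]mx11_scalar mul_mx_scalar !mxE mulrC.
have comb (a1 a2 : F) : exists b c,
    ((b != 0) || (c != 0)) /\ b *: a1%:M + c *: a2%:M = 0 :> 'M_1.
  have [a10|a10] := eqVneq a1 0.
    by exists 1, 0; rewrite oner_neq0 a10 scale0r addr0 raddf0 scaler0.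
  exists (- a2), a1; rewrite a10 orbT !scale_scalar_mx -raddfD; split=> //.
  by rewrite mulNr mulrC addNr raddf0.
exfalso; apply: (@spec1_doubly_bad 3 (quot_space S)) => //.
  exact: quot_spec2.
split=> u u0.
  have [|r [s [br bs rs]]] := vb (row_mx 0 u).
    by rewrite row_mx_eq0 negb_and u0 orbT.
  have [b [c [bc bcE]]] := comb (lsubmx r 0 0) (lsubmx s 0 0).
  have [Tt Dt] : bad S (row_mx 0 u) (b *: r + c *: s).
    case: (badZ b br) (badZ c bs) => T1 D1 [T2 D2].
    by split; rewrite ?tensDr ?memvD // dotDr D1 D2 addr0.
  have tE : b *: r + c *: s = row_mx 0 (b *: rsubmx r + c *: rsubmx s).
    rewrite -[r in LHS](@hsubmxK F 1 1 3) -[s in LHS](@hsubmxK F 1 1 3).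
    rewrite !scale_row_mx add_row_mx; congr row_mx.
    by rewrite [lsubmx r]mx11_scalar [lsubmx s]mx11_scalar.
  rewrite tE in Tt Dt; exists (b *: rsubmx r + c *: rsubmx s).
    apply: contraL bc => /eqP t0; move: tE; rewrite t0 row_mx0 => /rs[-> ->].
    by rewrite eqxx.
  by split; [exact: quotT Tt | rewrite -Dt dotT !mxE mul0r add0r].
have [|r [s [/bad_tr br /bad_tr bs rs]]] := vb' (row_mx 0 u).
  by rewrite row_mx_eq0 negb_and u0 orbT.
have ok t : bad S t (row_mx 0 u) -> rsubmx t != 0 ->
    exists2 e, e != 0 & bad (quot_space S) e u.
  rewrite -[t](@hsubmxK F 1 1 3) row_mxKr => -[Tt Dt] t0; exists (rsubmx t) => //.
  by split; [exact: quotT Tt | rewrite -Dt dotT !mxE mulr0 add0r].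
have [r0|] := eqVneq (rsubmx r) 0; last exact: ok.
have [s0|] := eqVneq (rsubmx s) 0; last exact: ok.
have [b [c [bc bcE]]] := comb (lsubmx r 0 0) (lsubmx s 0 0).
case: (rs b c) => [|b0 c0]; last by rewrite b0 c0 eqxx in bc.
rewrite -[r](@hsubmxK F 1 1 3) -[s](@hsubmxK F 1 1 3) r0 s0.
rewrite !scale_row_mx add_row_mx !scaler0 addr0.
by rewrite [lsubmx r]mx11_scalar [lsubmx s]mx11_scalar bcE row_mx0.
Qed.

Lemma dim_spec2 n (S : {vspace 'M[F]_n}) : (3 <= n)%N -> spec2 S ->
  (\dim S <= if n == 4%N then 'C(n, 2) + 4 else 'C(n, 2) + 3)%N.
Proof.
case: n S => // m S m2 S2; rewrite ltnS in m2.
(* First rows count at most m + 1, the quotient C(m, 2) + 2, and C(m + 1, 2) = C(m, 2) + m. *)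
have step k (S' : {vspace 'M[F]_(1 + m)}) : eig_sub S' S ->
    (\dim (line_space S') <= k)%N -> (\dim S' <= 'C(m.+1, 2) + 3 + k)%N.
  move=> /eig_sub_spec2/(_ S2)/quot_spec2/(dim_spec1 m2) dq dl.
  rewrite dim_reduction binS bin1; move: dq dl (dim_top_space S').
  by move: (\dim (top_space S')) (\dim (quot_space S')) (\dim (line_space S')); lia.
case: eqP => [m4|m4].
  have m3 : m = 3%N by case: m4.
  subst m; have [S' [dS sub dl]] := spec2_n4_reduction S2.
  by have := step _ _ sub dl; rewrite dS -addnA.
have [|S' [dS sub dl]] := @doubly_bad_reduction m S.
  by case=> ab ac; have [] := all_bad_n4 h2 x0 x1 (_ : (3 <= m.+1)%N) S2 ab ac.
by have := step 0%N _ sub; rewrite dl dS addn0; apply.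
Qed.

End Bounds.

(** * A space attaining the bound *)

Section Extremal.

Variables (F : fieldType) (n : nat).
Hypothesis n2 : (2 <= n)%N.

Definition o1 : 'I_n.+1 := inord 1.
Definition o2 : 'I_n.+1 := inord 2.
(** [inord] falls back to index 0 when out of range; [o3] is used only for n = 3, that is size 4. *)
Definition o3 : 'I_n.+1 := inord 3.

(* Lower-triangular positions left free: together with the two equal entries on
   the diagonal they give a block of trace zero (characteristic 2) in the rows
   0 and 1, and a scalar diagonal below; for matrices of size 4 the rows 2 and 3
   carry a second block of trace zero. *)
Definition free_low : seq ('I_n.+1 * 'I_n.+1) :=
  [:: (ord0, ord0); (o1, ord0); (o2, o2)] ++ (if n == 3%N then [:: (o3, o2)] else [::]).

Definition constrained (p : 'I_n.+1 * 'I_n.+1) :=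
  (p.2 <= p.1)%N && (p \notin free_low).

Definition diag_rep (i : 'I_n.+1) : 'I_n.+1 := if (i < 2)%N then ord0 else o2.

(** A linear map to a space whose dimension is the number of constrained positions, so that
    rank-nullity bounds its kernel from below. *)
Definition constraint (M : 'M[F]_n.+1) : {ffun {p | constrained p} -> F^o} :=
  [ffun p => M (val p).1 (val p).2 -
    (if (val p).1 == (val p).2 then M (diag_rep (val p).1) (diag_rep (val p).1) else 0)].

Fact constraint_linear : linear constraint.
Proof.
move=> a A B; apply/ffunP => p; rewrite !ffunE !mxE.
case: ifP => _; rewrite ?mxE; first by rewrite [_ *: _]mulrDr; ring.
by rewrite !subr0.
Qed.
HB.instance Definition _ := GRing.isLinear.Build F _ _ _ constraint constraint_linear.

Definition extremal_space : {vspace 'M[F]_n.+1} := lker (linfun constraint).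

Lemma extremal_spaceP M : M \in extremal_space -> forall i j, constrained (i, j) ->
  M i j = if i == j then M (diag_rep i) (diag_rep i) else 0.
Proof.
rewrite memv_ker lfunE /= => /eqP/ffunP M0 i j c.
by move/eqP: (M0 (exist _ (i, j) c)); rewrite !ffunE subr_eq0 => /eqP.
Qed.

Lemma val_o1 : val o1 = 1%N. Proof. by rewrite /= inordK //; lia. Qed.
Lemma val_o2 : val o2 = 2%N. Proof. by rewrite /= inordK //; lia. Qed.

Lemma card_strict_pairs N :
  #|[pred p : 'I_N * 'I_N | (p.1 < p.2)%N]| = 'C(N, 2).
Proof.
rewrite -sum1_card -(pair_big_dep xpredT (fun i j : 'I_N => (i < j)%N) (fun _ _ => 1%N)) /=.
rewrite (exchange_big_dep xpredT) //= -bin2_sum big_mkord.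
apply: eq_bigr => j _.
by rewrite -(big_ord_widen N (fun=> 1%N)) 1?ltnW // sum1_card card_ord.
Qed.

Lemma size_free_low : size free_low = (if n == 3%N then 4 else 3)%N.
Proof. by rewrite /free_low; case: eqP. Qed.

Lemma dim_extremal_space :
  ('C(n.+1, 2) + size free_low <= \dim extremal_space)%N.
Proof.
have := limg_ker_dim (linfun constraint) fullv; rewrite capfv -/extremal_space.
have -> : \dim {:'M[F]_n.+1} = (n.+1 * n.+1)%N by rewrite dimvf.
have : (\dim (linfun constraint @: fullv) <= #|[pred p | constrained p]|)%N.
  by rewrite (leq_trans (dimvS (subvf _))) // dimvf /dim /= muln1 card_sig.
pose low := [pred p : 'I_n.+1 * 'I_n.+1 | (p.2 <= p.1)%N].
have : (#|low| + 'C(n.+1, 2))%N = (n.+1 * n.+1)%N.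
  transitivity #|{: 'I_n.+1 * 'I_n.+1}|; last by rewrite card_prod card_ord.
  rewrite -card_strict_pairs -(cardC low); congr (_ + _)%N; apply: eq_card => p.
  by rewrite !inE -ltnNge.
have := cardID (mem free_low) low.
have : (size free_low <= #|[predI low & mem free_low]|)%N.
  have /card_uniqP <- : uniq free_low.
    rewrite /free_low; have [v1 v2] := (val_o1, val_o2).
    case: eqP => n3; rewrite /= !inE !xpair_eqE -!(inj_eq val_inj) v1 v2 //=.
    by rewrite /= inordK ?n3.
  apply: subset_leq_card; apply/subsetP => p pf; apply/andP; split; last exact: pf.
  rewrite /low /=.
  move: pf; rewrite mem_cat !inE; have [v1 v2] := (val_o1, val_o2).
  case/orP; first by case/or3P => /eqP-> //=.
  by case: eqP => n3; rewrite ?inE // => /eqP->; rewrite /= !inordK ?n3.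
have -> : #|[predD low & mem free_low]| = #|[pred p | constrained p]|.
  by apply: eq_card => p; rewrite !inE andbC.
move: (\dim extremal_space) (\dim (linfun constraint @: fullv)) => d1 d2.
move: #|[predI low & mem free_low]| #|low| #|[pred p | constrained p]| => c1 c2 c3.
lia.
Qed.

End Extremal.

Lemma trace0_block_eigenvalue (L : fieldType) (p q s v0 v1 l : L) :
  v0 * p + v1 * s = l * v0 -> v0 * q + v1 * p = l * v1 ->
  (v0 != 0) || (v1 != 0) -> (l - p) ^+ 2 = s * q.
Proof.
move=> E0 E1; have F0 : (l - p) * v0 = v1 * s by rewrite mulrBl -E0; ring.
have F1 : (l - p) * v1 = v0 * q by rewrite mulrBl -E1; ring.
case/orP=> v; apply: (mulIf v).
  by rewrite expr2 -mulrA F0 mulrA [_ * v1]F1; ring.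
by rewrite expr2 -mulrA F1 mulrA [_ * v0]F0; ring.
Qed.

(** Squaring is injective in characteristic 2, so a 2 by 2 block with equal diagonal entries has at
    most one eigenvalue in any extension. *)
Lemma char2_sqr_shift_inj (L : fieldType) (p k a b : L) : 2%:R = 0 :> L ->
  (a - p) ^+ 2 = k -> (b - p) ^+ 2 = k -> a = b.
Proof.
move=> h2 <- E; apply/eqP; rewrite -subr_eq0 -sqrf_eq0.
have -> : (a - b) ^+ 2 = (a - p) ^+ 2 - (b - p) ^+ 2 + 2%:R * (b - p) * (b - a) by ring.
by rewrite E subrr h2 !mul0r addr0.
Qed.

Lemma card_at_most_two (T : eqType) (P : pred T) (P1 P2 : T -> Prop) :
    (forall a, P a -> P1 a \/ P2 a) -> (forall a b, P1 a -> P1 b -> a = b) ->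
    (forall a b, P2 a -> P2 b -> a = b) ->
  card_at_most 2 P.
Proof.
move=> P12 inj1 inj2 [|a [|b [|c s]]] //= /and4P[]; rewrite !inE !negb_or.
case/and3P=> ab ac _ /andP[bc _] _ _ /and4P[/P12 Pa /P12 Pb /P12 Pc _]; exfalso.
case: Pa Pb Pc => ? [] ? [] ?.
all: first [case/eqP: ab; by [exact: inj1 | exact: inj2]
  | case/eqP: ac; by [exact: inj1 | exact: inj2]
  | case/eqP: bc; by [exact: inj1 | exact: inj2]].
Qed.

(** A row eigenvector nonzero at index 0 or 1 restricts to one of the top block. Otherwise it is
    supported on the indices >= 2, where it belongs to the second block in size 4, and to a
    triangular block with scalar diagonal in other sizes. *)
Lemma extremal_space_spec (F L : fieldType) (iota : {rmorphism F -> L}) n :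
  (2 <= n)%N -> 2%:R = 0 :> F -> spec_in iota 2 (extremal_space F n).
Proof.
move=> n2 h2 M /extremal_spaceP ME.
have h2L : 2%:R = 0 :> L by rewrite -(rmorph_nat iota) h2 rmorph0.
pose m i j := iota (M i j).
pose k2 := if n == 3%N then m (o3 n) (o2 n) * m (o2 n) (o3 n) else 0.
apply: (@card_at_most_two _ _
  (fun l => (l - m ord0 ord0) ^+ 2 = m (o1 n) ord0 * m ord0 (o1 n))
  (fun l => (l - m (o2 n) (o2 n)) ^+ 2 = k2)); last 2 first.
- by move=> a b; apply: char2_sqr_shift_inj.
- by move=> a b; apply: char2_sqr_shift_inj.
move=> l; rewrite /spectrum -mxminpoly_map -eigenvalue_root_min.
case/eigenvalueP=> v vM v0.
have col (j : 'I_n.+1) : \sum_i v 0 i * m i j = l * v 0 j.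
  move/rowP/(_ j): vM; rewrite !mxE => <-.
  by apply: eq_bigr => i _; rewrite mxE.
have two (i1 i2 j : 'I_n.+1) : i1 != i2 ->
    (forall i, i != i1 -> i != i2 -> v 0 i * m i j = 0) ->
    v 0 i1 * m i1 j + v 0 i2 * m i2 j = l * v 0 j.
  move=> i12 Z; rewrite -col (bigD1 i1) //= (bigD1 i2) 1?eq_sym //= big1 ?addr0 //.
  by move=> i /andP[]; apply: Z.
have [v1 v2] := (val_o1 n2, val_o2 n2).
have low0 (i j : 'I_n.+1) : (j < i)%N -> (i, j) \notin free_low n -> m i j = 0.
  move=> ji nf; rewrite /m ME; last by rewrite /constrained /= ltnW.
  by rewrite -(inj_eq val_inj) gtn_eqF // rmorph0.
have m11 : m (o1 n) (o1 n) = m ord0 ord0.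
  rewrite /m ME ?eqxx /diag_rep; first by rewrite -[nat_of_ord _]/(val (o1 n)) v1.
  rewrite /constrained leqnn /= /free_low mem_cat !inE !xpair_eqE.
  rewrite -!(inj_eq val_inj) v1 v2 /=.
  by case: eqP; rewrite ?inE // xpair_eqE -!(inj_eq val_inj) v1 v2 andbF.
have nfree (i j : 'I_n.+1) : (2 <= i)%N -> (j < 2)%N -> (i, j) \notin free_low n.
  move=> i2 j2; have jo2 : (j == o2 n) = false.
    by rewrite -(inj_eq val_inj) v2 ltn_eqF.
  have io0 : (i == ord0) = false by rewrite -(inj_eq val_inj) gtn_eqF // ltnW.
  have io1 : (i == o1 n) = false by rewrite -(inj_eq val_inj) v1 gtn_eqF.
  rewrite /free_low mem_cat !inE !xpair_eqE jo2 io0 io1 !andbF /=.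
  by case: (n == 3%N); rewrite ?inE ?xpair_eqE ?jo2 ?andbF.
have ge2 (i : 'I_n.+1) : i != ord0 -> i != o1 n -> (2 <= i)%N.
  by rewrite -!(inj_eq val_inj) v1 /=; case: (nat_of_ord i) => [|[]].
have o01 : ord0 != o1 n by rewrite -(inj_eq val_inj) v1.
have lt1 : (o1 n < 2)%N by rewrite -[nat_of_ord _]/(val (o1 n)) v1.
have [v01|] := boolP ((v 0 ord0 != 0) || (v 0 (o1 n) != 0)).
  left; apply: trace0_block_eigenvalue v01.
    by apply: two => // i i0 i1; rewrite low0 ?mulr0 ?nfree ?ge2 // (leq_trans _ (ge2 i i0 i1)).
  rewrite -m11; apply: two => // i i0 i1.
  by rewrite low0 ?mulr0 ?nfree ?ge2 // (leq_trans lt1 (ge2 i i0 i1)).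
rewrite negb_or !negbK => /andP[/eqP vo0 /eqP vo1]; right.
have [i0 vi0] := rV0Pn _ v0.
have vge2 i : v 0 i != 0 -> (2 <= i)%N.
  by move=> vi; apply: ge2; apply: contra_neq vi => ->.
rewrite /k2; case: (eqVneq n 3%N) => [n3|n3].
  have v3 : val (o3 n) = 3%N by rewrite /= inordK // n3.
  have m33 : m (o3 n) (o3 n) = m (o2 n) (o2 n).
    rewrite /m ME ?eqxx /diag_rep; first by rewrite -[nat_of_ord _]/(val (o3 n)) v3.
    rewrite /constrained leqnn /= /free_low mem_cat (introT eqP n3) !inE !xpair_eqE.
    have oo (a b : 'I_n.+1) : (a == b) = (val a == val b) by [].
    by rewrite !oo v1 v2 v3.
  have o23 : o2 n != o3 n by rewrite -(inj_eq val_inj) v2 v3.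
  have z i : i != o2 n -> i != o3 n -> v 0 i = 0.
    move=> i2 i3; apply/eqP/negPn/negP => /vge2 i_ge2.
    move: i2 i3; rewrite -!(inj_eq val_inj) v2 v3 /=.
    by have := ltn_ord i; rewrite {2}n3; lia.
  have v23 : (v 0 (o2 n) != 0) || (v 0 (o3 n) != 0).
    rewrite -negb_and; apply/negP => /andP[/eqP z2 /eqP z3]; case/eqP: vi0.
    have [->//|i2] := eqVneq i0 (o2 n); have [->//|i3] := eqVneq i0 (o3 n).
    exact: z.
  apply: trace0_block_eigenvalue v23.
    by apply: two => // i i2 i3; rewrite z ?mul0r.
  by rewrite -m33; apply: two => // i i2 i3; rewrite z ?mul0r.
(* At the first nonzero coordinate i of v, column i of v M = l v involves only v_i. *)
case: (@arg_minnP _ i0 (fun i => v 0 i != 0) (fun i => nat_of_ord i) vi0) => i vi imin.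
have i2 := vge2 i vi.
have lE : l = m i i.
  apply: (mulIf vi); rewrite -col (bigD1 i) //= big1 => [|k ki].
    by rewrite addr0 mulrC.
  have [->|vk] := eqVneq (v 0 k) 0; first by rewrite mul0r.
  rewrite low0 ?mulr0 //.
    by rewrite ltn_neqAle imin // andbT eq_sym.
  rewrite /free_low (negPf n3) cats0 !inE !xpair_eqE -!(inj_eq val_inj) v1 v2 /=.
  by move: ki (imin k vk); rewrite -(inj_eq val_inj) /=; lia.
rewrite lE; have [->|i_neq2] := eqVneq i (o2 n); first by rewrite subrr expr0n.
rewrite /m ME ?eqxx /diag_rep 1?ltnNge ?i2 /= ?subrr ?expr0n //.
rewrite /constrained leqnn /free_low (negPf n3) cats0 !inE !xpair_eqE.
by move: i_neq2; rewrite -!(inj_eq val_inj) v1 v2 /=; lia.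
Qed.

Theorem theorem1p7 (n : nat) (F : fieldType)
    (n_ge3 : (3 <= n.+1)%N)
    (charF2 : 2%N \in [pchar F])
    (cardF_gt2 : exists2 s : seq F, uniq s & (2 < size s)%N) :
  let d := if n.+1 == 4%N then ('C(n.+1, 2) + 4)%N else ('C(n.+1, 2) + 3)%N in
  greatest_dim (@two_spec F n) d /\
  (forall (Fbar : closedFieldType) (iota : {rmorphism F -> Fbar}),
     algebraic_closure iota ->
     greatest_dim (@two_bar_spec F Fbar iota n) d).
Proof.
move=> d; have h2 : 2%:R = 0 :> F by apply: pcharf0.
have [x x0 x1] : exists2 x : F, x != 0 & x != 1.
  case: cardF_gt2 => s us s2; apply: NNPP => no.
  suff: (size s <= size [:: 0%R; 1%R : F])%N by rewrite leqNgt s2.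
  apply: uniq_leq_size => // y ys; rewrite !inE; apply/negPn/negP.
  by rewrite negb_or => /andP[y0 y1]; apply: no; exists y.
(* [iota] is injective, so three distinct eigenvalues in F give three distinct roots in L: the bound
   over F serves for L. *)
have spec2_in (L : fieldType) (iota : {rmorphism F -> L}) (S : {vspace 'M[F]_n.+1}) :
    spec_in iota 2 S -> (\dim S <= d)%N.
  move=> spS; apply: (dim_spec2 h2 x0 x1 n_ge3) => M a b c MS Ma Mb Mc.
  have rt y : eigenvalue M y -> root (map_poly iota (mxminpoly M)) (iota y).
    by rewrite eigenvalue_root_min fmorph_root.
  apply/negP => abc; have := spS M MS [:: iota a; iota b; iota c].
  rewrite -[[:: _; _; _]]/(map iota [:: a; b; c]) map_inj_uniq; last exact: fmorph_inj.
  by rewrite abc /= /spectrum !rt // => /(_ isT isT).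
have greatest (L : fieldType) (iota : {rmorphism F -> L}) :
    greatest_dim (@spec_in F L iota 2 n) d.
  split; last exact: spec2_in.
  have exS := @extremal_space_spec F L iota n n_ge3 h2.
  exists (extremal_space F n) => //; apply/eqP; rewrite eqn_leq (spec2_in _ _ _ exS).
  apply: leq_trans (dim_extremal_space F n_ge3); rewrite size_free_low /d eqSS.
  by case: eqP.
split; first exact: greatest.
by move=> Fbar iota _; apply: greatest.
Qed.
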